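(* Let $M>0$ be an integer, let $a,b$ be two further indices, and let $$V=\exp\Big(\sum_{i,j\in\{a,b,1,\dots,M\}}\ \sum_{m,n\ge 0}A^{ij}_{mn}\,\psi^i_{m+1/2}\,\psi^{j*}_{-n-1/2}\Big)|0\rangle$$ be a Bogoliubov transform in the $(M+2)$-component fermionic Fock space $\mathcal F_1\otimes\cdots\otimes\mathcal F_M\otimes\mathcal F_a\otimes\mathcal F_b$. Let $\mathbf E=\{E^{ij}_{mn}: m,n\ge 0,\ i,j\in\{a,b\}\}$ be arbitrary coefficients (possibly with parameters), with associated gluing vector $$P^{\mathbf E}_{ab}=\exp\Big(\sum_{i,j\in\{a,b\}}\ \sum_{m,n\ge 0}Q^{m+n+1}\,\Theta^{\epsilon_{ij}}\,E^{ij}_{mn}\,\psi^i_{m+1/2}\,\psi^{j*}_{-n-1/2}\Big)|0\rangle\in\mathcal F_a\otimes\mathcal F_b ,$$ where $Q,\Theta$ are formal variables and $\epsilon_{ab}=1$, $\epsilon_{ba}=-1$, $\epsilon_{aa}=\epsilon_{bb}=0$. Define $\tilde G^{\mathbf E}(V)=(V,P^{\mathbf E}_{ab})$, the inner product being taken over the components $\mathcal F_a\otimes\mathcal F_b$; $$\tilde G^{\mathbf E}(V)_{closed}=\Big(\exp\Big(\sum_{i,j\in\{a,b\}}\sum_{m,n\ge 0}A^{ij}_{mn}\psi^i_{m+1/2}\psi^{j*}_{-n-1/2}\Big)|0\rangle_{ab},\ P^{\mathbf E}_{ab}\Big),$$ where $|0\rangle_{ab}$ is the vacuum of $\mathcal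 F_a\otimes\mathcal F_b$; and $G^{\mathbf E}(V)=\tilde G^{\mathbf E}(V)/\tilde G^{\mathbf E}(V)_{closed}$ (the normalized self-gluing of $V$). Then $G^{\mathbf E}(V)$ is a Bogoliubov transform in $\mathcal F_1\otimes\cdots\otimes\mathcal F_M$; that is, there are coefficients $R^{ij}_{mn}$ (formal power series in $Q,\Theta,\Theta^{-1}$) such that $$G^{\mathbf E}(V)=\exp\Big(\sum_{i,j=1}^M\sum_{m,n\ge 0}R^{ij}_{mn}\,\psi^i_{m+1/2}\,\psi^{j*}_{-n-1/2}\Big)|0\rangle .$$
   Context: Fermionic Fock space. A set $A=\{a_1>a_2>\cdots\}\subset\mathbb Z+\frac12$ is admissible if both $\{r\in\mathbb Z+\frac12: r<0\}\setminus A$ and $A\setminus\{r\in\mathbb Z+\frac12: r<0\}$ are finite. $\mathcal F$ is the vector space with orthonormal basis (for a bilinear inner product) the semi-infinite wedges $\underline A=\underline{a_1}\wedge\underline{a_2}\wedge\cdots$, $A$ admissible. The vacuum is $|0\rangle=\underline{-\frac12}\wedge\underline{-\frac32}\wedge\cdots$. For $r\in\mathbb Z+\frac12$: $\psi_r(\underline A)=(-1)^k\,\underline{a_1}\wedge\cdots\wedge\underline{a_k}\wedge\underline r\wedge\underline{a_{k+1}}\wedge\cdots$ if $a_k>r>a_{k+1}$ (with $k=0$ if $r>a_1$), and $0$ if $r\in A$; $\psi_r^*(\underline A)=(-1)^{k+1}\,\underline{a_1}\wedge\cdots\wedge\widehat{\underline{a_k}}\wedge\cdots$ if $a_k=r$,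 and $0$ if $r\notin A$. Then $\psi_r,\psi_r^*$ are adjoint, $\psi_r\psi_s^*+\psi_s^*\psi_r=\delta_{rs}$, and all other anticommutators vanish. For $r>0$, $\psi_r$ and $\psi^*_{-r}$ are the creators. Multi-component version. $\mathcal F_i$ are copies of $\mathcal F$ labelled by indices $i$. On a tensor product of several $\mathcal F_i$, $\psi^i_r,\psi^{i*}_r$ act on the $i$-th factor as $\psi_r,\psi_r^*$, with the Koszul sign convention, so that operators with different upper indices anticommute: $[\psi^i_r,\psi^j_s]_+=[\psi^i_r,\psi^{j*}_s]_+=[\psi^{i*}_r,\psi^{j*}_s]_+=0$ for $i\ne j$. $|0\rangle$ denotes the tensor product of the vacua; the tensor product carries the induced inner product. Bogoliubov transform. A vector of the form $\exp(\sum_{i,j}\sum_{m,n\ge0}A^{ij}_{mn}\psi^i_{m+1/2}\psi^{j*}_{-n-1/2})|0\rangle$, where $i,j$ run over the indices of the tensor factors and $A^{ij}_{mn}$ are arbitrary coefficients, possibly depending on parameters (i.e. lying in a commutative ring containing $\mathbb Q$). Infinite sums of basis vectors are allowed and understood formally. $\tilde G^{\mathbf E}(V)$, $\tilde G^{\mathbf E}(V)_{closed}$ and $G^{\mathbf E}(V)$ are viewed as formal power series in $Q,\Theta,\Theta^{-1}$ (each coefficient of a power of $Q$ involves only finitely many basis vectors of $\mathcal F_a\otimes\mathcal F_b$ and finitely many powers of $\Theta$); the coefficient of $Q^0$ in $\tilde G^{\mathbf E}(V)_{closed}$ is $1$, so the quotient makes sense. *)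

(* Defs.v *)
From HB Require Import structures.
From mathcomp Require Import all_boot all_order all_algebra finmap.
From mathcomp Require Import boolp classical_sets functions cardinality fsbigop.

Set Implicit Arguments.
Unset Strict Implicit.
Unset Printing Implicit Defensive.
Import Order.TTheory GRing.Theory Num.Theory.

Local Open Scope classical_set_scope.
Local Open Scope ring_scope.

(* Laurent polynomials over R in one variable Theta: finitely supported
   families of coefficients indexed by the exponents of Theta. *)
Record laurent (R : comNzRingType) := Laurent {
  lcoef :> int -> R;
  _ : `[< finite_set [set k | lcoef k != 0] >]
}.

HB.instance Definition _ (R : comNzRingType) := [isSub for @lcoef R].
HB.instance Definition _ (R : comNzRingType) := [Choice of laurent R by <:].

Section LaurentRing.
Variable R : comNzRingType.
Implicit Types (f g h : laurent R) (k : int).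

Lemma laurentP f g : (forall k, f k = g k) <-> f = g.
Proof. by split=> [fg|->//]; apply/val_inj/funext. Qed.

Definition lsupp f : {fset int} := fset_set [set k | f k != 0].

Lemma lsuppN0 f k : k \notin lsupp f -> f k = 0.
Proof.
have ffin : finite_set [set k | f k != 0] by exact/asboolP/(valP f).
by rewrite in_fset_set // => /negP H; apply/eqP/negPn/negP=> fk; apply/H/mem_set.
Qed.

Fact laurent_subproof (A : {fset int}) (c : int -> R) :
  (forall k, k \notin A -> c k = 0) -> `[< finite_set [set k | c k != 0] >].
Proof.
by move=> H; apply/asboolP/(finite_subfset A) => k; apply: contraNT => /H ->.
Qed.

Definition lmono (x : R) (e : int) : laurent R.
Proof.
refine (@Laurent R (fun k => if k == e then x else 0)
  (@laurent_subproof [fset e]%fset _ _)).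
by move=> k; rewrite inE => /negPf ->.
Defined.

Definition lzero : laurent R := lmono 0 0.
Definition lone : laurent R := lmono 1 0.

Definition lopp f : laurent R.
Proof.
refine (@Laurent R (fun k => - f k) (@laurent_subproof (lsupp f) _ _)).
by move=> k /lsuppN0 ->; rewrite oppr0.
Defined.

Definition ladd f g : laurent R.
Proof.
refine (@Laurent R (fun k => f k + g k)
  (@laurent_subproof (lsupp f `|` lsupp g)%fset _ _)).
by move=> k; rewrite inE negb_or => /andP[/lsuppN0-> /lsuppN0->]; rewrite addr0.
Defined.

Let conv f (c : int -> R) k : R := \sum_(i \in [set: int]) f i * c (k - i).

Let convE (A : {fset int}) f c k : {subset lsupp f <= A} ->
  conv f c k = \sum_(i <- A) f i * c (k - i).
Proof.
move=> fA; rewrite /conv (fsbigTE A) // => i iA.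
by rewrite lsuppN0 ?mul0r //; apply: contra iA => /fA.
Qed.

Definition lmul f g : laurent R.
Proof.
refine (@Laurent R (fun k => \sum_(i \in [set: int]) f i * g (k - i))
  (@laurent_subproof [fset (i + j)%R | i in lsupp f, j in lsupp g]%fset _ _)).
move=> k kN; rewrite -/(conv f g k) (convE (A := lsupp f)) // big_seq big1 //.
move=> i fi; rewrite [g _]lsuppN0 ?mulr0 //; apply: contra kN => gi.
by apply/imfset2P; exists i => //; exists (k - i) => //; rewrite addrC subrK.
Defined.

Fact laddA : associative ladd.
Proof. by move=> f g h; apply/laurentP => k /=; rewrite addrA. Qed.
Fact laddC : commutative ladd.
Proof. by move=> f g; apply/laurentP => k /=; rewrite addrC. Qed.
Fact ladd0 : left_id lzero ladd.
Proof. by move=> f; apply/laurentP => k /=; rewrite if_same add0r. Qed.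
Fact laddN : left_inverse lzero lopp ladd.
Proof. by move=> f; apply/laurentP => k /=; rewrite if_same addNr. Qed.

HB.instance Definition _ :=
  GRing.isZmodule.Build (laurent R) laddA laddC ladd0 laddN.

Fact lmulA : associative lmul.
Proof.
move=> f g h; apply/laurentP => k.
rewrite -[LHS]/(conv f (conv g h) k) -[RHS]/(conv (lmul f g) h k).
set W : {fset int} := [fset (i + j)%R | i in lsupp f, j in lsupp g]%fset.
have Wsub : {subset lsupp (lmul f g) <= W}.
  move=> l; apply: contraLR => lW; rewrite in_fset_set; last first.
    exact/asboolP/(valP (lmul f g)).
  apply/negP => /set_mem /=; rewrite -/(conv f g l) (convE (A := lsupp f)) //.
  rewrite big_seq big1 ?eqxx // => i fi.
  rewrite [g _]lsuppN0 ?mulr0 //; apply: contra lW => gi.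
  by apply/imfset2P; exists i => //; exists (l - i) => //; rewrite addrC subrK.
rewrite (convE _ _ Wsub) (convE (A := lsupp f)) //.
transitivity (\sum_(i <- lsupp f) \sum_(l <- W) f i * (g (l - i) * h (k - l))).
  apply: eq_big_seq => i fi; rewrite -big_distrr /=; congr (_ * _).
  rewrite /conv (@reindex_fsbigT _ _ _ _ _ (fun l => l - i)); last first.
    by exists (fun l => l + i) => l; rewrite ?subrK ?addrK.
  rewrite (fsbigTE W) => [|l lW].
    by apply: eq_bigr => l _; rewrite opprB addrA subrK.
  rewrite [g _]lsuppN0 ?mul0r //; apply: contra lW => gi.
  by apply/imfset2P; exists i => //; exists (l - i) => //; rewrite addrC subrK.
rewrite exchange_big /=; apply: eq_bigr => l _.
rewrite -/(conv f g l) (convE (A := lsupp f)) // big_distrl /=.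
by apply: eq_bigr => i _; rewrite mulrA.
Qed.

Fact lmulC : commutative lmul.
Proof.
move=> f g; apply/laurentP => k /=.
rewrite (@reindex_fsbigT _ _ _ _ _ (fun i => k - i)); last first.
  by exists (fun i => k - i) => i; rewrite opprB [k + (i - k)]addrC subrK.
by apply: eq_fsbigr => i _; rewrite opprB [k + (i - k)]addrC subrK mulrC.
Qed.

Fact lmul1 : left_id lone lmul.
Proof.
move=> f; apply/laurentP => k /=.
rewrite (fsbigTE [fset 0]%fset) => [|i].
  by rewrite big_seq_fset1 eqxx mul1r subr0.
by rewrite inE => /negPf ->; rewrite mul0r.
Qed.

Fact lmulDl : left_distributive lmul ladd.
Proof.
move=> f g h; apply/laurentP => k.
rewrite -[LHS]/(conv (f + g) h k) -[RHS]/(conv f h k + conv g h k).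
pose A := (lsupp (f + g)%R `|` (lsupp f `|` lsupp g))%fset.
rewrite !(convE (A := A)) => [|i ig|i ig|i ig]; rewrite ?inE ?ig ?orbT //.
by rewrite -big_split; apply: eq_bigr => i _ /=; rewrite -mulrDl.
Qed.

Fact lone_neq0 : lone != lzero.
Proof. by apply/eqP => /laurentP/(_ 0)/eqP /=; rewrite oner_eq0. Qed.

HB.instance Definition _ :=
  GRing.Zmodule_isComNzRing.Build (laurent R) lmulA lmulC lmul1 lmulDl lone_neq0.

End LaurentRing.

Section LaurentAlgebra.
Variables (S : pzRingType) (R : comAlgType S).

Definition lscale (a : S) (f : laurent R) : laurent R.
Proof.
refine (@Laurent R (fun k => a *: f k) (@laurent_subproof _ (lsupp f) _ _)).
by move=> k /lsuppN0 ->; rewrite scaler0.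
Defined.

Fact lscaleA a b f : lscale a (lscale b f) = lscale (a * b) f.
Proof. by apply/laurentP => k /=; rewrite scalerA. Qed.
Fact lscale1 : left_id 1 lscale.
Proof. by move=> f; apply/laurentP => k /=; rewrite scale1r. Qed.
Fact lscaleDr : right_distributive lscale +%R.
Proof. by move=> a f g; apply/laurentP => k /=; rewrite scalerDr. Qed.
Fact lscaleDl f : {morph lscale^~ f : a b / a + b}.
Proof. by move=> a b; apply/laurentP => k /=; rewrite scalerDl. Qed.

HB.instance Definition _ := GRing.Zmodule_isLmodule.Build S (laurent R)
  lscaleA lscale1 lscaleDr lscaleDl.

Fact lscaleAl (a : S) (f g : laurent R) : a *: (f * g) = (a *: f) * g.
Proof.
apply/laurentP => k /=.
have nil i : i \notin lsupp f -> f i = 0 by exact: lsuppN0.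
rewrite (fsbigTE (lsupp f)) => [|i /nil->]; last by rewrite mul0r.
rewrite (fsbigTE (lsupp f)) => [|i /nil->]; last by rewrite scaler0 mul0r.
by rewrite scaler_sumr; apply: eq_bigr => i _; rewrite scalerAl.
Qed.

HB.instance Definition _ := GRing.Lmodule_isLalgebra.Build S (laurent R) lscaleAl.
HB.instance Definition _ := GRing.Lalgebra_isComAlgebra.Build S (laurent R).

End LaurentAlgebra.

(* Formal power series over R in one variable Q. *)
Record fps (R : comNzRingType) := Fps { fcoef :> nat -> R }.

HB.instance Definition _ (R : comNzRingType) := [isNew for @fcoef R].
HB.instance Definition _ (R : comNzRingType) := [Choice of fps R by <:].

Section FpsRing.
Variable R : comNzRingType.
Implicit Types (f g h : fps R) (n : nat).

Lemma fpsP f g : (forall n, f n = g n) <-> f = g.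
Proof. by split=> [fg|->//]; apply/val_inj/funext. Qed.

Definition fmono (x : R) (d : nat) : fps R :=
  Fps (fun n => if n == d then x else 0).
Definition fzero : fps R := fmono 0 0.
Definition fone : fps R := fmono 1 0.
Definition fopp f : fps R := Fps (fun n => - f n).
Definition fadd f g : fps R := Fps (fun n => f n + g n).
Definition fmul f g : fps R := Fps (fun n => \sum_(i < n.+1) f i * g (n - i)%N).

Fact faddA : associative fadd.
Proof. by move=> f g h; apply/fpsP => k /=; rewrite addrA. Qed.
Fact faddC : commutative fadd.
Proof. by move=> f g; apply/fpsP => k /=; rewrite addrC. Qed.
Fact fadd0 : left_id fzero fadd.
Proof. by move=> f; apply/fpsP => k /=; rewrite if_same add0r. Qed.
Fact faddN : left_inverse fzero fopp fadd.
Proof. by move=> f; apply/fpsP => k /=; rewrite if_same addNr. Qed.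

HB.instance Definition _ :=
  GRing.isZmodule.Build (fps R) faddA faddC fadd0 faddN.

Let trunc N f : {poly R} := \poly_(i < N) f i.

Let coef_trunc N f n : (n < N)%N -> (trunc N f)`_n = f n.
Proof. by rewrite coef_poly => ->. Qed.

Let coef_truncM N f g n : (n < N)%N -> (trunc N f * trunc N g)`_n = fmul f g n.
Proof.
move=> nN; rewrite coefM; apply: eq_bigr => i _.
by rewrite !coef_trunc //; apply: leq_ltn_trans nN; rewrite ?leq_subr // -ltnS.
Qed.

Fact fmulA : associative fmul.
Proof.
move=> f g h; apply/fpsP => n.
transitivity ((trunc n.+1 f * (trunc n.+1 g * trunc n.+1 h))`_n).
  rewrite coefM; apply: eq_bigr => i _.
  by rewrite coef_trunc // coef_truncM // ltnS leq_subr.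
rewrite mulrA coefM; apply: eq_bigr => i _.
by rewrite coef_truncM // coef_trunc // ltnS leq_subr.
Qed.

Fact fmulC : commutative fmul.
Proof.
by move=> f g; apply/fpsP => n; rewrite -(coef_truncM f g (ltnSn n)) mulrC coef_truncM.
Qed.

Fact fmul1 : left_id fone fmul.
Proof.
move=> f; apply/fpsP => n /=.
by rewrite big_ord_recl /= mul1r subn0 big1 ?addr0 // => i _; rewrite mul0r.
Qed.

Fact fmulDl : left_distributive fmul fadd.
Proof.
move=> f g h; apply/fpsP => n /=.
by rewrite -big_split; apply: eq_bigr => i _; rewrite mulrDl.
Qed.

Fact fone_neq0 : fone != fzero.
Proof. by apply/eqP => /fpsP/(_ 0%N)/eqP /=; rewrite oner_eq0. Qed.

HB.instance Definition _ :=
  GRing.Zmodule_isComNzRing.Build (fps R) fmulA fmulC fmul1 fmulDl fone_neq0.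

Definition funit : {pred fps R} := fun f => `[< exists g, g * f = 1 >].
Definition finv f : fps R :=
  if pselect (exists g, g * f = 1) is left ex then projT1 (cid ex) else f.

Fact fmulV : {in funit, left_inverse 1 finv *%R}.
Proof.
move=> f /asboolP uf; rewrite /finv; case: pselect => // ex.
exact: projT2 (cid ex).
Qed.
Fact funitP f g : g * f = 1 -> funit f.
Proof. by move=> gf; apply/asboolP; exists g. Qed.
Fact finv_out : {in [predC funit], finv =1 id}.
Proof. by move=> f /asboolPn nuf; rewrite /finv; case: pselect. Qed.

HB.instance Definition _ :=
  GRing.ComNzRing_hasMulInverse.Build (fps R) fmulV funitP finv_out.

Lemma fps_unit f : f 0%N = 1 -> f \is a GRing.unit.
Proof.
move=> f0.
pose step (s : seq R) := rcons s (- \sum_(i < size s) s`_i * f (size s - i)%N).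
pose s n := iter n step [:: 1 : R].
have ss n : size (s n) = n.+1 by elim: n => //= n IH; rewrite size_rcons IH.
pose g := Fps (fun n => (s n)`_n).
have sg m n : (m <= n)%N -> (s n)`_m = g m.
  elim: n => [|n IH]; first by rewrite leqn0 => /eqP ->.
  rewrite leq_eqVlt => /orP[/eqP->//|mn].
  by rewrite /= nth_rcons ss mn IH.
apply/unitrP; suff gf : g * f = 1 by exists g; rewrite [f * g]mulrC.
apply/fpsP => -[|n]; rewrite [LHS]/=; first by rewrite big_ord1 mul1r f0.
rewrite big_ord_recr /= subnn f0 mulr1 nth_rcons ss ltnn eqxx.
apply/eqP; rewrite addr_eq0 opprK; apply/eqP/eq_bigr => i _.
by rewrite sg // -ltnS.
Qed.

End FpsRing.

Section FpsAlgebra.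
Variables (S : pzRingType) (R : comAlgType S).

Definition fscale (a : S) (f : fps R) : fps R := Fps (fun n => a *: f n).

Fact fscaleA a b f : fscale a (fscale b f) = fscale (a * b) f.
Proof. by apply/fpsP => k /=; rewrite scalerA. Qed.
Fact fscale1 : left_id 1 fscale.
Proof. by move=> f; apply/fpsP => k /=; rewrite scale1r. Qed.
Fact fscaleDr : right_distributive fscale +%R.
Proof. by move=> a f g; apply/fpsP => k /=; rewrite scalerDr. Qed.
Fact fscaleDl f : {morph fscale^~ f : a b / a + b}.
Proof. by move=> a b; apply/fpsP => k /=; rewrite scalerDl. Qed.

HB.instance Definition _ := GRing.Zmodule_isLmodule.Build S (fps R)
  fscaleA fscale1 fscaleDr fscaleDl.

Fact fscaleAl (a : S) (f g : fps R) : a *: (f * g) = (a *: f) * g.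
Proof.
apply/fpsP => n /=.
by rewrite scaler_sumr; apply: eq_bigr => i _; rewrite scalerAl.
Qed.

HB.instance Definition _ := GRing.Lmodule_isLalgebra.Build S (fps R) fscaleAl.
HB.instance Definition _ := GRing.Lalgebra_isComAlgebra.Build S (fps R).

End FpsAlgebra.

(* Laurent series in Q, Theta with coefficients in K: the coefficient of each
   power of Q is a Laurent polynomial in Theta. *)
Notation series K := (fps (laurent K)).

(* The monomial x Q^d Theta^e. *)
Definition monomial (K : comNzRingType) (x : K) (d : nat) (e : int) : series K :=
  fmono (lmono x e) d.

Definition const_series (K : comNzRingType) (x : K) : series K := monomial x 0 0.

(* The integer k stands for the half-integer k + 1/2; thus Posz m stands for
   m + 1/2 and Negz n, which is - (n + 1), stands for - n - 1/2. *)
Definition negatives : set int := [set k : int | k < 0].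

Definition admissible (A : set int) : Prop :=
  finite_set (negatives `\` A) /\ finite_set (A `\` negatives).

Record admset := AdmSet { aset :> set int; _ : `[< admissible aset >] }.

HB.instance Definition _ := [isSub for aset].
HB.instance Definition _ := [Choice of admset by <:].

Lemma admsetP (A : admset) : admissible A.
Proof. exact/asboolP/(valP A). Qed.

Fact admissible_negatives : `[< admissible negatives >].
Proof. by apply/asboolP; split; rewrite setDv. Qed.

Definition avac : admset := AdmSet admissible_negatives.

Fact admissible_setU1 (A : admset) r : `[< admissible (A `|` [set r]) >].
Proof.
have [An Ap] := admsetP A; apply/asboolP; split.
  by apply: sub_finite_set An => k [nk nA]; split=> // Ak; apply: nA; left.
rewrite setDUl finite_setU; split=> //.
by apply: sub_finite_set (finite_set1 r) => k [].
Qed.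

Fact admissible_setD1 (A : admset) r : `[< admissible (A `\` [set r]) >].
Proof.
have [An Ap] := admsetP A; apply/asboolP; split; last first.
  by apply: sub_finite_set Ap => k [[Ak _] nk].
apply: (@sub_finite_set _ _ ((negatives `\` A) `|` [set r])).
  move=> k [nk nA]; have [->|kr] := eqVneq k r; first by right.
  by left; split=> // Ak; apply: nA; split=> //= /eqP; apply/negP.
by rewrite finite_setU.
Qed.

Definition aadd (r : int) (A : admset) : admset := AdmSet (admissible_setU1 A r).
Definition adel (r : int) (A : admset) : admset := AdmSet (admissible_setD1 A r).

(* The number of elements of A greater than r: this is k in the definition of
   psi_r and k - 1 in that of psi_r^*, where r = a_k. *)
Definition above (r : int) (A : admset) : nat :=
  #|` fset_set (A `&` [set s | r < s])|.

(* The number of creators producing the wedge of A from the vacuum; its parity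
   is the degree of that wedge in the Koszul rule. *)
Definition degree (A : admset) : nat :=
  (#|` fset_set (A `\` negatives)| + #|` fset_set (negatives `\` A)|)%N.

(* The basis of the tensor product of N copies of F, ordered by index. *)
Definition fbasis (N : nat) := {ffun 'I_N -> admset}.
HB.instance Definition _ N := Choice.on (fbasis N).

Definition fvac (N : nat) : fbasis N := [ffun => avac].

Definition replace_at N (B : fbasis N) (i : 'I_N) (A : admset) : fbasis N :=
  [ffun j => if j == i then A else B j].

Definition koszul N (i : 'I_N) (B : fbasis N) : nat :=
  (\sum_(j < N | j < i) degree (B j))%N.

(* Formal, possibly infinite, linear combinations of basis vectors. *)
Definition fock (L : comNzRingType) (N : nat) := fbasis N -> L.

Section Operators.
Variables (L : comNzRingType) (N : nat).
Implicit Types (B C : fbasis N) (v : fock L N).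

Definition ket B : fock L N := fun C => (C == B)%:R.

(* Here and below \sum_(_ \in _) is the library's sum over the support of the
   summand, which is finite in every use; it expresses that infinite sums of
   basis vectors are taken coefficient by coefficient. *)
Definition extend (op : fbasis N -> fock L N) v : fock L N :=
  fun C => \sum_(B \in [set: fbasis N]) v B * op B C.

Definition psi_basis (i : 'I_N) (r : int) B : fock L N := fun C =>
  if r \in (B i : set int) then 0
  else (-1) ^+ (koszul i B + above r (B i)) * ket (replace_at B i (aadd r (B i))) C.

Definition psistar_basis (i : 'I_N) (r : int) B : fock L N := fun C =>
  if r \in (B i : set int)
  then (-1) ^+ (koszul i B + above r (B i)) * ket (replace_at B i (adel r (B i))) C
  else 0.

Definition psi i r : fock L N -> fock L N := extend (psi_basis i r).
Definition psistar i r : fock L N -> fock L N := extend (psistar_basis i r).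

Lemma extend_ket op B : extend op (ket B) = op B.
Proof.
apply/funext => C; rewrite /extend (fsbigTE [fset B]%fset) => [|D].
  by rewrite big_seq_fset1 /ket eqxx mul1r.
by rewrite inE /ket => /negPf ->; rewrite mul0r.
Qed.

Definition bilinear_exponent (A : 'I_N -> 'I_N -> nat -> nat -> L) v : fock L N :=
  fun C => \sum_(i < N) \sum_(j < N) \sum_(mn \in [set: (nat * nat)%type])
    A i j mn.1 mn.2 * psi i (Posz mn.1) (psistar j (Negz mn.2) v) C.

End Operators.

Definition bogoliubov (L : comAlgType rat) (N : nat)
    (A : 'I_N -> 'I_N -> nat -> nat -> L) : fock L N :=
  fun C => \sum_(n \in [set: nat])
    (n`!%:R^-1 : rat) *: iter n (bilinear_exponent A) (ket L (fvac N)) C.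

(* The bilinear inner product with orthonormal basis, computed separately for
   each power of Q. *)
Definition inner (L : comNzRingType) (N : nat) (v w : fock (fps L) N) : fps L :=
  Fps (fun d => \sum_(C \in [set: fbasis N]) (v C * w C) d).

Definition fjoin M N (B : fbasis M) (C : fbasis N) : fbasis (M + N) :=
  [ffun k => match fintype.split k with inl i => B i | inr j => C j end].

Definition inner_last (L : comNzRingType) (M N : nat)
    (V : fock (fps L) (M + N)) (P : fock (fps L) N) : fock (fps L) M :=
  fun B => inner (fun C => V (fjoin B C)) P.

Section SelfGluing.
Variable K : comAlgType rat.

Definition extend_scalars N (v : fock K N) : fock (series K) N :=
  fun B => const_series (v B).

Definition idx_a : 'I_2 := ord0.
Definition idx_b : 'I_2 := ord_max.

Definition epsilon (i j : 'I_2) : int :=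
  if (i == idx_a) && (j == idx_b) then 1
  else if (i == idx_b) && (j == idx_a) then -1 else 0.

Definition gluing_vector (E : 'I_2 -> 'I_2 -> nat -> nat -> K) :
    fock (series K) 2 :=
  bogoliubov (fun i j m n => monomial (E i j m n) (m + n + 1) (epsilon i j)).

(* In 'I_(M + 2) the first M indices are 1, ..., M and the last two are a, b. *)
Definition gluing M (V : fock K (M + 2)) (E : 'I_2 -> 'I_2 -> nat -> nat -> K) :
    fock (series K) M :=
  inner_last (extend_scalars V) (gluing_vector E).

Definition gluing_closed M (A : 'I_(M + 2) -> 'I_(M + 2) -> nat -> nat -> K)
    (E : 'I_2 -> 'I_2 -> nat -> nat -> K) : series K :=
  inner (extend_scalars (bogoliubov (fun i j => A (rshift M i) (rshift M j))))
    (gluing_vector E).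

(* The denominator is a unit, by gluing_closed_unit below. *)
Definition normalized_gluing M (A : 'I_(M + 2) -> 'I_(M + 2) -> nat -> nat -> K)
    (E : 'I_2 -> 'I_2 -> nat -> nat -> K) : fock (series K) M :=
  fun B => gluing (bogoliubov A) E B / gluing_closed A E.

End SelfGluing.

Lemma psi_creator_vac (L : comNzRingType) N (i : 'I_N) m (v : fock L N) :
  psi i (Posz m) v (fvac N) = 0.
Proof.
rewrite /psi /extend fsbig1 // => B _; rewrite /psi_basis.
case: ifP => _; first by rewrite mulr0.
rewrite /ket; case: eqP => [E|_]; last by rewrite !mulr0.
have : aset (fvac N i) (Posz m) by rewrite E ffunE eqxx; right.
by rewrite ffunE.
Qed.

Lemma bogoliubov_vac (L : comAlgType rat) N
    (A : 'I_N -> 'I_N -> nat -> nat -> L) : bogoliubov A (fvac N) = 1.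
Proof.
rewrite /bogoliubov (fsbigTE [fset 0%N]%fset) => [|[|n]]; last 2 first.
- by rewrite inE eqxx.
- move=> _; rewrite iterS /bilinear_exponent big1 ?scaler0 // => i _.
  rewrite big1 // => j _; rewrite fsbig1 // => mn _.
  by rewrite psi_creator_vac mulr0.
by rewrite big_seq_fset1 /= /ket eqxx fact0 invr1 scale1r.
Qed.

Lemma fcoef0M (L : comNzRingType) (f g : fps L) : (f * g) 0%N = f 0%N * g 0%N.
Proof. by rewrite [LHS]/= big_ord1 subnn. Qed.

Lemma fcoef_sum0 (L : comNzRingType) n (I : Type) (r : seq I) (P : pred I)
    (F : I -> fps L) :
  (forall i, P i -> F i n = 0) -> (\sum_(i <- r | P i) F i) n = 0.
Proof.
move=> F0; elim/big_ind: _ => //=; first by rewrite if_same.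
by move=> f g -> ->; rewrite addr0.
Qed.

Lemma gluing_vector0 (K : comAlgType rat) (E : 'I_2 -> 'I_2 -> nat -> nat -> K) C :
  gluing_vector E C 0%N = (C == fvac 2)%:R.
Proof.
have [->|CN] := eqVneq C (fvac 2); first by rewrite /gluing_vector bogoliubov_vac.
rewrite /gluing_vector /bogoliubov; apply: fcoef_sum0 => -[|n] _.
  by rewrite /= /ket (negPf CN) /= scaler0.
rewrite iterS [LHS]/= [X in _ *: X]fcoef_sum0 ?scaler0 // => i _.
apply: fcoef_sum0 => j _; apply: fcoef_sum0 => mn _.
by rewrite fcoef0M /= addn1 mul0r.
Qed.

Lemma gluing_closed0 (K : comAlgType rat) M
    (A : 'I_(M + 2) -> 'I_(M + 2) -> nat -> nat -> K)
    (E : 'I_2 -> 'I_2 -> nat -> nat -> K) : gluing_closed A E 0%N = 1.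
Proof.
pose W := bogoliubov (fun i j => A (rshift M i) (rshift M j)).
rewrite -[LHS]/(\sum_(C \in [set: fbasis 2])
  (extend_scalars W C * gluing_vector E C) 0%N) (fsbigTE [fset fvac 2]%fset) => [|C].
  rewrite big_seq_fset1 fcoef0M gluing_vector0 eqxx mulr1.
  by rewrite /extend_scalars /W bogoliubov_vac.
by rewrite inE fcoef0M gluing_vector0 => /negPf ->; rewrite mulr0.
Qed.

Lemma gluing_closed_unit (K : comAlgType rat) M
    (A : 'I_(M + 2) -> 'I_(M + 2) -> nat -> nat -> K)
    (E : 'I_2 -> 'I_2 -> nat -> nat -> K) : gluing_closed A E \is a GRing.unit.
Proof. exact/fps_unit/gluing_closed0. Qed.

(* Main.v *)
(* A vector v with v(vac) = 1 is a Bogoliubov transform if and only if it solves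
   Hirota's bilinear identity: sum_r psi_r v (x) psi_r^* v = 0.  For an
   exponential exp(X)|0>, psi_p^* v is a combination of the psi_h^* v over the
   holes h, and psi_h v is minus the transposed combination of the psi_p v, so the
   two halves of the sum cancel.  Conversely, the identity at (vac + p, C - p)
   expands v(C) along the particle p like a Laplace expansion, so v is determined
   by its values on states with one particle and one hole, and these can be
   prescribed to be any A^{ij}_{mn} up to sign.
   The gluing preserves the identity: split the sum for V into the modes of the
   first M factors and those of a, b; the latter part, contracted with P (x) P,
   is moved by adjointness onto P, where it vanishes. *)

Require Import Defs.
From mathcomp Require Import all_boot all_order all_algebra.
From mathcomp Require Import finmap.
From mathcomp Require Import boolp classical_sets functions cardinality fsbigop.

Set Implicit Arguments.
Unset Strict Implicit.
Unset Printing Implicit Defensive.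
Import Order.TTheory GRing.Theory Num.Theory.

Local Open Scope classical_set_scope.
Local Open Scope ring_scope.

(** * Modes, occupation and signs *)

Lemma odd_cardfs_setD1 (S : set int) r : finite_set S -> S r ->
  odd #|` fset_set (S `\ r)| = ~~ odd #|` fset_set S|.
Proof.
move=> fS Sr; have rS : r \in fset_set S by rewrite in_fset_set ?inE.
by rewrite fset_setD1 // [in RHS](cardfsD1 r) rS add1n /= negbK.
Qed.

(** Symmetric difference with a single mode. As an involution it treats [psi] and [psistar]
    uniformly: both send a wedge to its flip, up to a sign, or to zero. *)
Definition aflip (r : int) (A : admset) : admset :=
  if r \in (A : set int) then adel r A else aadd r A.

Lemma admset_ext (A B : admset) : (forall s, aset A s <-> aset B s) -> A = B.
Proof. by move=> AB; apply/val_inj/seteqP; split=> s /AB. Qed.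

Lemma mem_aflip r (A : admset) s :
  (s \in (aflip r A : set int)) = (s == r) (+) (s \in (A : set int)).
Proof.
rewrite /aflip; case: ifP => rA; apply/idP/idP; rewrite ?inE /=.
- by case=> sA /eqP/negPf ->; apply/mem_set.
- by have [->|sr] /= := eqVneq s r; rewrite ?rA // inE => sA; split=> //; apply/eqP.
- case=> [sA|->]; last by rewrite eqxx rA.
  have /negPf -> /= : s != r by apply/eqP => E; rewrite -E mem_set in rA.
  exact/mem_set.
- by have [->|sr] /= := eqVneq s r; [right|rewrite inE; left].
Qed.

Lemma adelK r (A : admset) : r \notin (A : set int) -> adel r (aadd r A) = A.
Proof.
move=> /negP rA; apply: admset_ext => s; split=> /=.
  by case=> -[].
by move=> sA; split; [left|move=> E; apply: rA; rewrite -E; apply/mem_set].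
Qed.

Lemma mem_aadd r (A : admset) : r \in (aadd r A : set int).
Proof. by rewrite inE; right. Qed.

Lemma finite_above (s : int) (A : admset) : finite_set (A `&` [set t | s < t]).
Proof.
have [_ Ap] := admsetP A.
(* Admissibility bounds the nonnegative elements; a negative element above [s] is some [Negz k] with
   [k < |s|]. *)
apply: (@sub_finite_set _ _ ((A `\` negatives) `|`
    [set` [fset (Negz k) | k in iota 0 `|s|]%fset])).
  move=> t [At /= st]; have [t0|t0] := ltP t 0; last first.
    by left; split=> //=; rewrite /negatives /= ltNge t0.
  right; case: t At st t0 => // k _ st _ /=; apply/imfsetP; exists k => //=.
  rewrite mem_iota add0n /=; case: s st => [n|n]; first by [].
  by rewrite !NegzE ltrN2 ltz_nat abszN absz_nat => /leqW.
by rewrite finite_setU; split=> //; exact: finite_fset.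
Qed.

Lemma odd_above_adel (r s : int) (A : admset) : r \in (A : set int) ->
  odd (above s (adel r A)) = (s < r) (+) odd (above s A).
Proof.
rewrite inE => rA; rewrite /above; have [sr|rs] := ltP s r.
  have -> : adel r A `&` [set t | s < t] = (A `&` [set t | s < t]) `\ r.
    by apply/seteqP; split=> t /=; tauto.
  by rewrite odd_cardfs_setD1 //; exact: finite_above.
suff -> : adel r A `&` [set t | s < t] = A `&` [set t | s < t] by [].
apply/seteqP; split=> t /=; first by tauto.
by move=> [At st]; split=> //; split=> // E; move: st; rewrite E ltNge rs.
Qed.

Lemma odd_above_aflip (r s : int) (A : admset) :
  odd (above s (aflip r A)) = (s < r) (+) odd (above s A).
Proof.
rewrite /aflip; case: ifP => rA; first exact: odd_above_adel.
have := odd_above_adel s (mem_aadd r A).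
by rewrite adelK ?rA // => ->; rewrite addbA addbb.
Qed.

(** Removing a nonnegative mode destroys a particle and removing a negative one creates a hole;
    either way the degree changes by one. *)
Lemma odd_degree_adel r (A : admset) : r \in (A : set int) ->
  odd (degree (adel r A)) = ~~ odd (degree A).
Proof.
rewrite inE => rA; have [An Ap] := admsetP A; have [An' _] := admsetP (adel r A).
rewrite /degree !oddD; have [r0|r0] := ltP r 0.
  have -> : adel r A `\` negatives = A `\` negatives.
    apply/seteqP; split=> t /=; first by tauto.
    by move=> [At t0]; split=> //; split=> // E; apply: t0; rewrite E.
  have -> : negatives `\` A = (negatives `\` adel r A) `\ r.
    apply/seteqP; split=> t /=.
      by move=> [t0 At]; split=> [|E]; [tauto|apply: At; rewrite E].
    by move=> [[t0 At] tr]; split=> // At'; apply: At.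
  by rewrite odd_cardfs_setD1 ?addbN ?negbK //; split=> // -[_]; apply.
have -> : adel r A `\` negatives = (A `\` negatives) `\ r.
  by apply/seteqP; split=> t /=; tauto.
have -> : negatives `\` adel r A = negatives `\` A.
  apply/seteqP; split=> t /= [t0 At]; split=> // At'; apply: At.
    by split=> // E; move: t0; rewrite E /negatives /= ltNge r0.
  by case: At'.
by rewrite odd_cardfs_setD1 ?addNb //; split=> //; rewrite /negatives /= ltNge r0.
Qed.

Lemma odd_degree_aflip r (A : admset) :
  odd (degree (aflip r A)) = ~~ odd (degree A).
Proof.
rewrite /aflip; case: ifP => rA; first exact: odd_degree_adel.
by have := odd_degree_adel (mem_aadd r A); rewrite adelK ?rA // => ->; rewrite negbK.
Qed.

Notation mode N := ('I_N * int)%type.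

Section Basis.
Variable N : nat.
Implicit Types (x y : mode N) (B C D : fbasis N).

Definition occ x C : bool := x.2 \in (C x.1 : set int).

Definition flip x C : fbasis N := replace_at C x.1 (aflip x.2 (C x.1)).

(** Only the parity of the exponent matters; as a boolean, signs multiply by [(+)]. *)
Definition sgn x C : bool := odd (koszul x.1 C + above x.2 (C x.1)).

(** The order of the wedge factors: smaller component first, then larger half-integer. Flipping [y]
    changes the sign of the operators at [x] exactly when [y] comes before [x]. *)
Definition precedes y x : bool := (y.1 < x.1)%N || (y.1 == x.1) && (x.2 < y.2).

Lemma fbasis_ext C D : (forall x, occ x C = occ x D) -> C = D.
Proof.
move=> CD; apply/ffunP => i; apply: admset_ext => s.
by have := CD (i, s); rewrite /occ /= => E; split=> /mem_set H; apply/set_mem; move: H; rewrite E.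
Qed.

Lemma occ_vac x : occ x (fvac N) = (x.2 < 0).
Proof. by rewrite /occ ffunE; apply/idP/idP; rewrite inE. Qed.

Lemma occ_flip y x C : occ y (flip x C) = (y == x) (+) occ y C.
Proof.
rewrite /occ ffunE -pair_eqE /pair_eq /=.
by have [->|] //= := eqVneq y.1 x.1; rewrite mem_aflip.
Qed.

Lemma flipK x : involutive (flip x).
Proof. by move=> C; apply: fbasis_ext => y; rewrite !occ_flip addbA addbb. Qed.

Lemma flipC x y C : flip x (flip y C) = flip y (flip x C).
Proof. by apply: fbasis_ext => z; rewrite !occ_flip addbCA. Qed.

Lemma odd_koszul_flip y C i :
  odd (koszul i (flip y C)) = (y.1 < i)%N (+) odd (koszul i C).
Proof.
have deg j : j != y.1 -> degree (flip y C j) = degree (C j).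
  by rewrite ffunE => /negPf ->.
rewrite /koszul; have [yi|yi] := ltnP y.1 i.
  have E : flip y C y.1 = aflip y.2 (C y.1) by rewrite ffunE eqxx.
  rewrite !(bigD1 (P := fun j : 'I_N => (j < i)%N) y.1) //= !(oddD (degree _)) E.
  rewrite odd_degree_aflip -addNb; congr (_ (+) odd _).
  by apply: eq_bigr => j /andP[_ /deg].
congr odd; apply: eq_bigr => j ji; apply: deg.
by apply: contraTneq ji => ->; rewrite -leqNgt.
Qed.

Lemma sgn_flip x y C : sgn x (flip y C) = precedes y x (+) sgn x C.
Proof.
rewrite /sgn !oddD odd_koszul_flip /precedes ffunE -addbA eq_sym.
have [E|yx] := eqVneq x.1 y.1; last by rewrite orbF.
by rewrite E ltnn /= odd_above_aflip addbCA.
Qed.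

Lemma precedes_total x y : x != y -> precedes x y = ~~ precedes y x.
Proof.
rewrite -pair_eqE /pair_eq /precedes [y.1 == _]eq_sym -!(inj_eq val_inj) /=.
by case: ltngtP => //= _; rewrite eq_sym; case: ltgtP.
Qed.

Lemma precedesxx x : precedes x x = false.
Proof. by rewrite /precedes ltnn eqxx ltxx. Qed.

End Basis.

(** * Fermionic operators *)

Section Ladder.
Variables (L : comNzRingType) (N : nat).
Implicit Types (x y : mode N) (b c : bool) (C D : fbasis N) (v w : fock L N).

(** [ladder true] is [psi] and [ladder false] is [psistar], written coefficientwise: [b] is the
    occupation of [x] after the operator has acted. Taking the sign at [C] rather than at [flip x C]
    is harmless, since no mode precedes itself. *)
Definition ladder b x v : fock L N := fun C =>
  if occ x C == b then (-1) ^+ sgn x C * v (flip x C) else 0.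

Lemma extend_ladder b x (op : fbasis N -> fock L N) v :
  (forall B C, op B C = if occ x B == ~~ b
     then (-1) ^+ sgn x B * (C == flip x B)%:R else 0) ->
  extend op v = ladder b x v.
Proof.
move=> opE; apply/funext => C; rewrite /extend /ladder.
rewrite (fsbigTE [fset flip x C]%fset) => [|B]; last first.
  rewrite inE opE => BC; case: ifP => _; last by rewrite mulr0.
  case: eqP => [E|_]; last by rewrite !mulr0.
  by rewrite E flipK eqxx in BC.
rewrite big_seq_fset1 opE flipK eqxx mulr1 occ_flip eqxx sgn_flip precedesxx /=.
by rewrite (inj_eq negb_inj); case: ifP; rewrite ?mulr0 // mulrC.
Qed.

Lemma psiE x v : psi x.1 x.2 v = ladder true x v.
Proof.
apply: extend_ladder => B C; rewrite /psi_basis /ket /occ /= /flip /aflip.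
by case: ifP => xB; rewrite ?xB //= /sgn signr_odd.
Qed.

Lemma psistarE x v : psistar x.1 x.2 v = ladder false x v.
Proof.
apply: extend_ladder => B C; rewrite /psistar_basis /ket /occ /= /flip /aflip.
by case: ifP => xB; rewrite ?xB //= /sgn signr_odd.
Qed.

Lemma ladder_ext b x v w C : v =1 w -> ladder b x v C = ladder b x w C.
Proof. by move=> vw; rewrite /ladder vw. Qed.

Lemma ladderZ b x (a : L) v C :
  ladder b x (fun D => a * v D) C = a * ladder b x v C.
Proof. by rewrite /ladder; case: ifP => _; rewrite ?mulr0 // mulrCA. Qed.

Lemma ladderN b x v C : ladder b x (fun D => - v D) C = - ladder b x v C.
Proof. by rewrite /ladder; case: ifP => _; rewrite ?oppr0 // mulrN. Qed.

Lemma ladderD b x v w C :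
  ladder b x (fun D => v D + w D) C = ladder b x v C + ladder b x w C.
Proof. by rewrite /ladder; case: ifP => _; rewrite ?addr0 // mulrDr. Qed.

Lemma ladder_sum b x (I : Type) (r : seq I) (P : pred I) (F : I -> fock L N) C :
  ladder b x (fun D => \sum_(i <- r | P i) F i D) C =
  \sum_(i <- r | P i) ladder b x (F i) C.
Proof.
rewrite /ladder; case: ifP => _; first by rewrite mulr_sumr.
by rewrite big1.
Qed.

(** Of two distinct modes exactly one precedes the other, so exchanging the operators flips exactly
    one of the two signs. *)
Lemma ladder_anticomm_neq b c x y v C : x != y ->
  ladder b x (ladder c y v) C = - ladder c y (ladder b x v) C.
Proof.
move=> xy; rewrite /ladder !occ_flip [y == x]eq_sym (negPf xy) /= flipC.
case: ifP => _; case: ifP => _; rewrite ?mulr0 ?oppr0 //.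
rewrite !sgn_flip (precedes_total xy) !signr_addb.
by case: (precedes y x); rewrite /= ?mul1r ?mulN1r ?mulNr ?mulrN ?opprK mulrCA.
Qed.

Lemma ladder_anticomm b x y v C :
  ladder b x (ladder b y v) C = - ladder b y (ladder b x v) C.
Proof.
have [->|/ladder_anticomm_neq->//] := eqVneq x y.
rewrite /ladder occ_flip eqxx; case: b; case: occ => /=; rewrite ?mulr0 ?oppr0 //.
Qed.

Lemma ladder_anticommN b x y v C :
  ladder b x (ladder (~~ b) y v) C =
  (x == y)%:R * v C - ladder (~~ b) y (ladder b x v) C.
Proof.
have [->|xy] := eqVneq x y; last by rewrite mul0r add0r ladder_anticomm_neq.
rewrite /ladder occ_flip eqxx flipK sgn_flip precedesxx /=.
have signK : (-1) ^+ sgn y C * ((-1) ^+ sgn y C * v C) = v C.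
  by rewrite mulrA -signr_addb addbb mul1r.
by case: b; case: occ => /=; rewrite ?signK ?mulr0 ?mul1r ?subr0 ?subrr.
Qed.

(** The condition on [b] singles out the annihilators: [psi] at negative modes and [psistar] at
    nonnegative ones. *)
Lemma ladder_vac b x C : b = (x.2 < 0) -> ladder b x (ket L (fvac N)) C = 0.
Proof.
move=> ->; rewrite /ladder /ket; case: eqP => // xC.
case: eqP => [E|_]; last by rewrite mulr0.
have := occ_vac x; rewrite -E occ_flip eqxx xC.
by case: (_ < _).
Qed.

End Ladder.

(** * Finite windows of modes *)

Section Window.
Variable N : nat.
Implicit Types (x y : mode N) (C D : fbasis N) (n : nat).

(* The half-integers between -n and n. *)
Definition win n : seq int :=
  [seq Posz m | m <- iota 0 n] ++ [seq Negz m | m <- iota 0 n].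

Definition modes n : seq (mode N) := [seq (i, r) | i <- enum 'I_N, r <- win n].

Lemma mem_win n r : (r \in win n) = match r with Posz m => m < n | Negz m => m < n end%N.
Proof.
rewrite mem_cat; apply/orP/idP.
  by case=> /mapP[m]; rewrite mem_iota => mn ->.
case: r => m mn; [left|right]; apply/mapP; exists m => //; by rewrite mem_iota.
Qed.

Lemma uniq_win n : uniq (win n).
Proof.
rewrite cat_uniq !map_inj_uniq ?iota_uniq //=; try by move=> ? ? [].
by rewrite andbT; apply/hasPn => r /mapP[m _ ->]; apply/negP => /mapP[].
Qed.

Lemma mem_modes n x : (x \in modes n) = (x.2 \in win n).
Proof.
case: x => i r; apply/allpairsP/idP => /= [[[j s] /= [_ sn [_ ->]]] //|rn].
by exists (i, r); rewrite mem_enum.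
Qed.

Lemma uniq_modes n : uniq (modes n).
Proof. by apply: allpairs_uniq => [||[? ?] [? ?]] //; rewrite ?enum_uniq ?uniq_win. Qed.

Lemma leq_modes m n x : (m <= n)%N -> x \in modes m -> x \in modes n.
Proof.
rewrite !mem_modes !mem_win => mn; case: x.2 => k km; exact: leq_trans km mn.
Qed.

(** Agreement with the vacuum outside the window. Every basis state lies in some window, which
    reduces infinite sums to finite ones. *)
Definition inwin n C : Prop := forall x, x \notin modes n -> occ x C = (x.2 < 0).

Lemma inwin_leq m n C : (m <= n)%N -> inwin m C -> inwin n C.
Proof. by move=> mn Cm x xn; apply: Cm; apply: contra xn; exact: leq_modes. Qed.

Lemma inwin_flip n x C : x \in modes n -> inwin n C -> inwin n (flip x C).
Proof.
move=> xn Cn y yn; rewrite occ_flip -Cn //.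
by case: eqP yn xn => [->/negPf->|].
Qed.

Lemma inwin_vac n : inwin n (fvac N).
Proof. by move=> x _; rewrite occ_vac. Qed.

Lemma inwin_ex C : exists n, inwin n C.
Proof.
have bnd i : exists n, forall r, r \notin win n -> (r \in (C i : set int)) = (r < 0).
  have [An Ap] := admsetP (C i).
  pose S := (fset_set (negatives `\` C i) `|` fset_set (C i `\` negatives))%fset.
  exists (\max_(r <- S) `|r|).+1%N => r rn.
  have rS : r \notin S.
    apply: contra rn => rS.
    have le : (`|r| <= \max_(r <- S) `|r|)%N by rewrite (big_rem r) //= leq_maxl.
    by rewrite mem_win; case: r rS le => k _ //= le; rewrite ltnS // ltnW.
  move: rS; rewrite inE !in_fset_set // negb_or => /andP[/negP rS1 /negP rS2].
  apply/idP/idP => [rC|r0].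
    by apply: contra_notT rS2 => r0; apply/mem_set; split; [exact/set_mem|exact/negP].
  by apply: contra_notT rS1 => /negP rC; apply/mem_set; split=> // rC'; apply/rC/mem_set.
pose f i := projT1 (cid (bnd i)).
exists (\max_i f i)%N => -[i r]; rewrite mem_modes /= => rn.
apply: (projT2 (cid (bnd i))); apply: contra rn; rewrite !mem_win.
have le : (f i <= \max_i f i)%N by exact: leq_bigmax.
by case: r => k kn; apply: leq_trans le.
Qed.

(** This grades the powers of the exponent and later serves as the induction measure for
    uniqueness. *)
Definition nparticles n C : nat := \sum_(x <- modes n | 0 <= x.2) occ x C.

Lemma nparticles_flip n p C : p \in modes n -> 0 <= p.2 -> occ p C ->
  nparticles n C = (nparticles n (flip p C)).+1.
Proof.
move=> pn p0 pC; rewrite /nparticles -!(big_filter (modes n)); set s := filter _ _.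
have ps : p \in s by rewrite mem_filter p0.
have us : uniq s by rewrite filter_uniq ?uniq_modes.
rewrite !(bigD1_seq p) //= occ_flip eqxx pC add1n add0n; congr _.+1.
by apply: eq_bigr => x xp; rewrite occ_flip (negPf xp).
Qed.

Lemma nparticles_flip_hole n h C : h.2 < 0 -> nparticles n (flip h C) = nparticles n C.
Proof.
move=> h0; apply: eq_bigr => x x0; rewrite occ_flip; case: eqP => // xh.
by rewrite xh leNgt h0 in x0.
Qed.

Lemma nparticles_vac n : nparticles n (fvac N) = 0%N.
Proof. by apply: big1 => x x0; rewrite occ_vac ltNge x0. Qed.

Lemma leq_nparticles n C : (nparticles n C <= size (modes n))%N.
Proof.
rewrite /nparticles -sum1_size big_mkcond /=.
by apply: leq_sum => x _; case: ifP => // _; case: occ.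
Qed.

End Window.

(** * Commuting annihilators through the exponent *)

Section Exponential.
Variables (N n : nat).
Implicit Types (x y p h : mode N) (b : bool) (C D : fbasis N).

Section Hop.
Variables (L : comNzRingType) (a : mode N -> mode N -> L).
Implicit Types (v w : fock L N).

(** The exponent of a Bogoliubov transform cut down to a window. *)
Definition hop v : fock L N := fun C =>
  \sum_(p <- modes N n | 0 <= p.2) \sum_(h <- modes N n | h.2 < 0)
    a p h * ladder true p (ladder false h v) C.

(* The commutator of ladder b x with hop, see ladder_hop. *)
Definition contract b x v : fock L N := fun C =>
  \sum_(p <- modes N n | 0 <= p.2) \sum_(h <- modes N n | h.2 < 0)
    a p h * ((-1) ^+ b * (x == if b then h else p)%:R *
      ladder b (if b then p else h) v C).

(** Moving [psi] at [x] through a term picks up minus the delta with the hole and leaves the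
    operator at [p]; moving [psistar] picks up the delta with the particle and leaves the operator
    at [h]. *)
Lemma ladder_hop b x v C :
  ladder b x (hop v) C = hop (ladder b x v) C + contract b x v C.
Proof.
rewrite ladder_sum -big_split /=; apply: eq_bigr => p _.
rewrite ladder_sum -big_split /=; apply: eq_bigr => h _.
rewrite ladderZ -mulrDr; congr (_ * _); case: b; rewrite /= ?mul1r ?mulN1r.
  rewrite ladder_anticomm (_ : ladder true x (ladder (~~ true) h v) =
    fun C => (x == h)%:R * v C - ladder false h (ladder true x v) C); last first.
    by apply/funext => D; rewrite ladder_anticommN.
  rewrite ladderD ladderN ladderZ opprD opprK addrC; congr (_ + _).
  by rewrite mulNr.
rewrite (ladder_anticommN false) addrC; congr (_ + _).
rewrite (_ : ladder false x (ladder false h v) =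
  fun C => - ladder false h (ladder false x v) C); last first.
  by apply/funext => D; rewrite ladder_anticomm.
by rewrite ladderN opprK.
Qed.

Lemma hopZ (c : L) v C : hop (fun D => c * v D) C = c * hop v C.
Proof.
rewrite /hop mulr_sumr; apply: eq_bigr => p _; rewrite mulr_sumr.
apply: eq_bigr => h _; rewrite [RHS]mulrCA; congr (_ * _); rewrite -ladderZ.
by apply: ladder_ext => D; rewrite ladderZ.
Qed.

Lemma hop_sum (I : Type) (r : seq I) (P : pred I) (F : I -> fock L N) C :
  hop (fun D => \sum_(i <- r | P i) F i D) C = \sum_(i <- r | P i) hop (F i) C.
Proof.
rewrite /hop [RHS]exchange_big /=; apply: eq_bigr => p _.
rewrite [RHS]exchange_big /=; apply: eq_bigr => h _.
rewrite -mulr_sumr -ladder_sum; congr (_ * _).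
by apply: ladder_ext => D; rewrite ladder_sum.
Qed.

(** Creators commute with the exponent: a particle is never a hole. *)
Lemma contract_uncontracted b x v C :
  b = (0 <= x.2) -> contract b x v C = 0.
Proof.
move=> bx; rewrite /contract big1 // => p p0; rewrite big1 // => h h0.
suff /negPf -> : x != if b then h else p by rewrite mulr0 mul0r mulr0.
apply: contraTneq p0 => xE; rewrite {b}bx in xE; move: xE; case: ifP => x0 xE.
  by rewrite xE leNgt h0 in x0.
by rewrite -xE x0.
Qed.

(** The commutator of a ladder operator with the exponent is a combination of creators, hence
    commutes with the exponent again. *)
Lemma contract_hop b x v C : contract b x (hop v) C = hop (contract b x v) C.
Proof.
rewrite {2}/contract hop_sum; apply: eq_bigr => p p0.
rewrite hop_sum; apply: eq_bigr => h h0.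
rewrite !hopZ ladder_hop contract_uncontracted ?addr0 //.
by case: b; rewrite ?p0 // leNgt h0.
Qed.

Notation hops k := (iter k hop (ket L (fvac N))).

(** The derivation rule [[psi, X^k] = k [psi, X] X^(k-1)], valid because the commutator is central
    with respect to [X]; the remaining term annihilates the vacuum. *)
Lemma ladder_hops b x k C : b = (x.2 < 0) ->
  ladder b x (hops k) C = k%:R * contract b x (hops k.-1) C.
Proof.
move=> bx; elim: k C => [|k IH] C; first by rewrite mul0r ladder_vac.
rewrite ladder_hop /= (_ : ladder b x _ = fun D => k%:R * contract b x (hops k.-1) D).
  rewrite hopZ -contract_hop -[X in _ + X]mul1r -natr1 [RHS]mulrDl.
  (* For [k = 0] the predecessor is a dummy value, killed by the factor zero. *)
  by case: k {IH} => [|k] //=; rewrite !mul0r.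
by apply/funext => D; rewrite IH.
Qed.

(** Each hop creates exactly one particle in the window. *)
Lemma hops_eq0 k C : nparticles n C != k -> hops k C = 0.
Proof.
elim: k C => [|k IH] C /= Ck.
  by rewrite /ket; case: (C =P fvac N) Ck => [->|//]; rewrite nparticles_vac.
rewrite /hop big_seq_cond big1 // => p /andP[pn p0]; rewrite big1 // => h h0.
rewrite /ladder; case: eqP => [pC|_]; last by rewrite mulr0.
case: ifP => _; last by rewrite !mulr0.
rewrite IH ?mulr0 //; apply: contra Ck; rewrite nparticles_flip_hole //.
by rewrite (nparticles_flip pn p0 pC) eqSS.
Qed.

Lemma contract_particle x v C : x \in modes N n -> 0 <= x.2 ->
  contract false x v C = \sum_(h <- modes N n | h.2 < 0) a x h * ladder false h v C.
Proof.
move=> xn x0; rewrite /contract -big_filter (bigD1_seq x) ?filter_uniq ?uniq_modes //=.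
  rewrite eqxx [X in _ + X]big1 ?addr0 => [|p px].
    by apply: eq_bigr => h _; rewrite !mul1r.
  by rewrite big1 // => h _; rewrite eq_sym (negPf px) mulr0 mul0r mulr0.
by rewrite mem_filter x0.
Qed.

Lemma contract_hole x v C : x \in modes N n -> x.2 < 0 ->
  contract true x v C = - \sum_(p <- modes N n | 0 <= p.2) a p x * ladder true p v C.
Proof.
move=> xn x0; rewrite /contract -sumrN; apply: eq_bigr => p _.
rewrite -big_filter (bigD1_seq x) ?filter_uniq ?uniq_modes //=.
  rewrite eqxx [X in _ + X]big1 ?addr0 => [|h hx].
    by rewrite mulr1 mulN1r mulrN.
  by rewrite eq_sym (negPf hx) mulr0 mul0r mulr0.
by rewrite mem_filter x0.
Qed.

(* The coefficient at (C, D) of sum_r psi_r v (x) psi_r^* v: only modes r in C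
   but not in D contribute, hence only modes of the window. *)
Definition bilinear_identity v : Prop := forall C D, inwin n C -> inwin n D ->
  \sum_(x <- modes N n) ladder true x v C * ladder false x v D = 0.

Lemma contract_bilinear v :
  (forall b x C, b = (x.2 < 0) -> ladder b x v C = contract b x v C) ->
  bilinear_identity v.
Proof.
move=> vE C D _ _; rewrite (bigID (fun x => 0 <= x.2)) /=.
(* The particle half of the sum equals [S] and the hole half equals [- S]. *)
pose S := \sum_(p <- modes N n | 0 <= p.2) \sum_(h <- modes N n | h.2 < 0)
  a p h * (ladder true p v C * ladder false h v D).
have -> : \sum_(p <- modes N n | 0 <= p.2) ladder true p v C * ladder false p v D = S.
  rewrite big_seq_cond [RHS]big_seq_cond; apply: eq_bigr => p /andP[pn p0].
  rewrite (vE false) ?contract_particle ?ltNge ?p0 // mulr_sumr.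
  by apply: eq_bigr => h _; rewrite mulrCA.
rewrite /S exchange_big /=.
rewrite [X in _ + X](eq_bigl (fun x : mode N => x.2 < 0)) => [|x]; last by rewrite ltNge.
rewrite -big_split /= big_seq_cond big1 // => h /andP[hn h0].
rewrite (vE true) ?contract_hole ?h0 // mulNr mulr_suml; apply/eqP.
by rewrite subr_eq0; apply/eqP/eq_bigr => p _; rewrite mulrA.
Qed.

End Hop.
End Exponential.

(** * Bogoliubov transforms satisfy the bilinear identity *)

Section ModeSums.
Variables (N n : nat) (V : nmodType).

Lemma sum_modes (P : pred int) (F : mode N -> V) :
  \sum_(x <- modes N n | P x.2) F x = \sum_(i < N) \sum_(r <- win n | P r) F (i, r).
Proof.
rewrite big_mkcond big_allpairs big_enum /=; apply: eq_bigr => i _.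
by rewrite [RHS]big_mkcond.
Qed.

Lemma sum_particles (F : mode N -> V) :
  \sum_(x <- modes N n | 0 <= x.2) F x =
  \sum_(i < N) \sum_(m <- iota 0 n) F (i, Posz m).
Proof.
rewrite (sum_modes (fun r => 0 <= r)); apply: eq_bigr => i _.
by rewrite big_cat !big_map /= [X in _ + X]big_pred0 ?addr0.
Qed.

Lemma sum_holes (F : mode N -> V) :
  \sum_(x <- modes N n | x.2 < 0) F x =
  \sum_(i < N) \sum_(m <- iota 0 n) F (i, Negz m).
Proof.
rewrite (sum_modes (fun r => r < 0)); apply: eq_bigr => i _.
by rewrite big_cat !big_map /= [X in X + _]big_pred0 ?add0r.
Qed.

End ModeSums.

Lemma fsbigT_seq (V : nmodType) (T : choiceType) (r : seq T) (F : T -> V) :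
  uniq r -> (forall i, i \notin r -> F i = 0) ->
  \sum_(i \in [set: T]) F i = \sum_(i <- r) F i.
Proof.
move=> ur F0; rewrite (fsbigE r) //; last by move=> i _; exact: F0.
by apply: eq_bigl => i; rewrite in_setT.
Qed.

Section Bogoliubov.
Variables (L : comAlgType rat) (N : nat).
Implicit Types (x y p h : mode N) (b : bool) (C D : fbasis N) (v w : fock L N).

Lemma contractZ n a b x (c : L) v C :
  contract n a b x (fun D => c * v D) C = c * contract n a b x v C.
Proof.
rewrite /contract mulr_sumr; apply: eq_bigr => p _; rewrite mulr_sumr.
by apply: eq_bigr => h _; rewrite ladderZ [RHS]mulrCA [in RHS](mulrCA c).
Qed.

Lemma contract_sum n a b x (I : Type) (r : seq I) (P : pred I)
    (F : I -> fock L N) C :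
  contract n a b x (fun D => \sum_(i <- r | P i) F i D) C =
  \sum_(i <- r | P i) contract n a b x (F i) C.
Proof.
rewrite /contract [RHS]exchange_big /=; apply: eq_bigr => p _.
rewrite [RHS]exchange_big /=; apply: eq_bigr => h _.
by rewrite ladder_sum -!mulr_sumr.
Qed.

Definition exp_hop n a K : fock L N := fun C =>
  \sum_(k < K) (k`!%:R^-1 : rat) *: iter k (hop n a) (ket L (fvac N)) C.

(** The exponential series terminates: a further term would need more particles than the window has
    modes. *)
Lemma exp_hopS n a K : (size (modes N n) < K)%N ->
  exp_hop n a K.+1 =1 exp_hop n a K.
Proof.
move=> nK C; rewrite /exp_hop big_ord_recr /= hops_eq0 ?scaler0 ?addr0 //.
by rewrite ltn_eqF // (leq_ltn_trans (leq_nparticles n C)).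
Qed.

(** An annihilator lowers the order by one and [k / k! = 1 / (k-1)!], so the truncation drops from
    [K.+1] to [K]. *)
Lemma ladder_exp_hop n a K b x C : b = (x.2 < 0) ->
  ladder b x (exp_hop n a K.+1) C = contract n a b x (exp_hop n a K) C.
Proof.
have algE k' : exp_hop n a k' = fun D => \sum_(k < k')
    ((k`!%:R^-1 : rat)%:A * iter k (hop n a) (ket L (fvac N)) D).
  by apply/funext => D; apply: eq_bigr => k _; rewrite mulr_algl.
move=> bx; rewrite !algE ladder_sum contract_sum big_ord_recl /=.
rewrite ladderZ ladder_vac // mulr0 add0r; apply: eq_bigr => k _.
rewrite ladderZ contractZ -iterS (@ladder_hops _ n _ a b x k.+1) // mulrA; congr (_ * _).
rewrite -scalerAl mul1r -scaler_nat scalerA; congr (_ *: _).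
rewrite factS natrM invfM mulrC mulrA mulfV ?mul1r //.
by rewrite pnatr_eq0.
Qed.

(* The hole Negz k has absolute value k + 1. *)
Definition mode_coef (A : 'I_N -> 'I_N -> nat -> nat -> L) p h : L :=
  A p.1 h.1 `|p.2|%N `|h.2|.-1%N.

(** A state of the window has neither particles nor holes outside it, so a pair with an outer mode
    cannot have been created and contributes zero. *)
Lemma bilinear_exponent_window n A v w C : inwin n C ->
  (forall D, inwin n D -> v D = w D) ->
  bilinear_exponent A v C = hop n (mode_coef A) w C.
Proof.
move=> Cn vw; rewrite /hop sum_particles; apply: eq_bigr => i _.
under [RHS]eq_bigr => m _ do rewrite sum_holes.
rewrite [RHS]exchange_big /=; apply: eq_bigr => j _.
rewrite (@fsbigT_seq _ _ [seq (m, k) | m <- iota 0 n, k <- iota 0 n]); first last.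
- move=> [m k] /= mk; rewrite (psiE (i, Posz m)) (psistarE (j, Negz k)) /ladder.
  rewrite occ_flip /=; have [mn|mn] := ltnP m n; last first.
    by rewrite Cn ?mulr0 //= mem_modes mem_win -leqNgt.
  have [kn|kn] := ltnP k n; last first.
    rewrite [occ (j, _) _]Cn ?mem_modes ?mem_win -?leqNgt //=.
    by rewrite -pair_eqE /pair_eq andbF; case: ifP; rewrite /= ?mulr0.
  by case/negP: mk; apply/allpairsP; exists (m, k); split; rewrite //= mem_iota add0n.
- by apply: allpairs_uniq => [||[? ?] [? ?]] //; rewrite ?iota_uniq.
rewrite big_allpairs big_seq [RHS]big_seq; apply: eq_bigr => m.
rewrite mem_iota => mn; rewrite big_seq [RHS]big_seq; apply: eq_bigr => k.
rewrite mem_iota => kn; rewrite (psiE (i, Posz m)) (psistarE (j, Negz k)).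
congr (_ * _); rewrite /ladder; case: ifP => // _; case: ifP => // _.
rewrite vw //; apply: inwin_flip; last apply: inwin_flip; by rewrite ?mem_modes ?mem_win.
Qed.

Lemma bogoliubov_window n A C K : inwin n C -> (size (modes N n) < K)%N ->
  bogoliubov A C = exp_hop n (mode_coef A) K C.
Proof.
move=> Cn nK.
have itE k D : inwin n D -> iter k (bilinear_exponent A) (ket L (fvac N)) D =
    iter k (hop n (mode_coef A)) (ket L (fvac N)) D.
  elim: k D => //= k IH D Dn; exact: bilinear_exponent_window.
rewrite /bogoliubov (@fsbigT_seq _ _ (index_iota 0 K)) ?iota_uniq //=.
  rewrite big_mkord; apply: eq_bigr => k _.
  by rewrite itE.
move=> k; rewrite mem_index_iota /= -leqNgt => Kk.
rewrite itE // hops_eq0 ?scaler0 // ltn_eqF //.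
exact: leq_ltn_trans (leq_nparticles n C) (leq_trans nK Kk).
Qed.

Lemma ladder_window n b x v w C : x \in modes N n -> inwin n C ->
  (forall D, inwin n D -> v D = w D) -> ladder b x v C = ladder b x w C.
Proof.
by move=> xn Cn vw; rewrite /ladder; case: ifP => // _; rewrite vw //; apply: inwin_flip.
Qed.

Lemma bogoliubov_bilinear n A : bilinear_identity n (bogoliubov A : fock L N).
Proof.
set K := (size (modes N n)).+1.
have EK D : inwin n D -> bogoliubov A D = exp_hop n (mode_coef A) K D.
  by move=> Dn; apply: bogoliubov_window.
have bil : bilinear_identity n (exp_hop n (mode_coef A) K).
  apply: (@contract_bilinear _ _ _ (mode_coef A)) => b x C bx.
  (* The truncation is already stationary at [K], so the annihilator relation holds for one and the
     same vector. *)
  by rewrite -ladder_exp_hop //; apply: ladder_ext => D; rewrite exp_hopS.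
move=> C D Cn Dn; rewrite -[RHS](bil C D Cn Dn) big_seq [RHS]big_seq.
apply: eq_bigr => x xn.
by rewrite (ladder_window _ xn Cn EK) (ladder_window _ xn Dn EK).
Qed.

(** The annihilator relation for [psistar] at [p], read at the vacuum with hole [h], retains the
    single term of [h], whose vector coefficient is the vacuum one, namely 1. *)
Lemma bogoliubov_pair A p h : 0 <= p.2 -> h.2 < 0 ->
  bogoliubov A (flip p (flip h (fvac N))) =
  (-1) ^+ (sgn p (flip h (fvac N)) (+) sgn h (flip h (fvac N))) * mode_coef A p h.
Proof.
move=> p0 h0; set C := flip h _.
have [n [pn hn]] : exists n, p \in modes N n /\ h \in modes N n.
  exists (maxn `|p.2| `|h.2|).+1.
  rewrite !mem_modes !mem_win; split.
    by case: p.2 => k; rewrite ltnS leq_max ?leqnn //= ltnW.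
  by case: h.2 => k; rewrite ltnS leq_max ?leqnn ?orbT //= [X in _ || X]ltnW ?orbT.
set K := (size (modes N n)).+1.
have EK D : inwin n D -> bogoliubov A D = exp_hop n (mode_coef A) K D.
  by move=> Dn; apply: bogoliubov_window.
have Cn : inwin n C by apply: inwin_flip => //; exact: inwin_vac.
have ph : p != h by apply: contraTneq p0 => ->; rewrite -ltNge.
have pC : occ p C = false by rewrite occ_flip occ_vac (negPf ph) /= ltNge p0.
have hC : occ h C = false by rewrite occ_flip occ_vac eqxx h0.
have := @ladder_exp_hop n (mode_coef A) K false p C; rewrite ltNge p0 => /(_ erefl).
rewrite contract_particle // -big_filter (bigD1_seq h) ?filter_uniq ?uniq_modes //=; last first.
  by rewrite mem_filter h0.
(* Every other hole mode is occupied in [C], so its [psistar] vanishes there. *)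
rewrite [X in _ + X]big1_seq ?addr0 => [|x /andP[xh]]; last first.
  rewrite mem_filter => /andP[x0 _].
  by rewrite /ladder occ_flip occ_vac x0 (negPf xh) /= mulr0.
rewrite /ladder pC hC eqxx flipK -EK; last exact: inwin_vac.
rewrite exp_hopS // -EK; last exact: inwin_flip.
rewrite bogoliubov_vac mulr1 => E.
rewrite -[LHS]mul1r -[X in X * _](expr0 (-1)) -[0%N]/(nat_of_bool false).
rewrite -(addbb (sgn p C)) signr_addb -mulrA E signr_addb -mulrA.
by rewrite [mode_coef A p h * _]mulrC.
Qed.

End Bogoliubov.

(** * Uniqueness and gluing over a finite window *)

Section Uniqueness.
Variables (L : comNzRingType) (N : nat).
Implicit Types (x y p h : mode N) (C D : fbasis N) (v w : fock L N).

(** The identity at [(C, D)] solved for its term at [x]; this is the Laplace expansion along [x]. *)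
Lemma bilinear_pivot n x v C D : bilinear_identity n v -> inwin n C -> inwin n D ->
  x \in modes N n -> occ x C -> ~~ occ x D ->
  v (flip x C) * v (flip x D) = - (-1) ^+ (sgn x C (+) sgn x D) *
    \sum_(y <- modes N n | y != x) ladder true y v C * ladder false y v D.
Proof.
move=> bil Cn Dn xn xC /negPf xD; have := bil C D Cn Dn.
rewrite (bigD1_seq x) ?uniq_modes //= => /eqP; rewrite addr_eq0 => /eqP E.
rewrite mulNr -mulrN -E /ladder xC xD /= signr_addb mulrACA.
by rewrite ![(-1) ^+ _ * (_ * v _)]mulrA -!signr_addb !addbb !mul1r.
Qed.

Lemma bilinear_unique v w :
  (forall n, bilinear_identity n v) -> (forall n, bilinear_identity n w) ->
  v (fvac N) = 1 -> w (fvac N) = 1 ->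
  (forall p h, 0 <= p.2 -> h.2 < 0 ->
     v (flip p (flip h (fvac N))) = w (flip p (flip h (fvac N)))) ->
  v = w.
Proof.
move=> bv bw v1 w1 vw; apply/funext => C; have [n] := inwin_ex C.
have [k] := ubnP (nparticles n C); elim: k C => // k IH C kC Cn.
(* With a particle [p], expand along [p]: each surviving [h] is negative, so the first factor is a
   one-pair coefficient and the second belongs to a state with one particle fewer. *)
have [/hasP[p pn /andP[p0 pC]]|/hasPn noP] :=
  boolP (has (fun x : mode N => (0 <= x.2) && occ x C) (modes N n)).
  have vac_p : inwin n (flip p (fvac N)) by apply: inwin_flip => //; exact: inwin_vac.
  have pCn : inwin n (flip p C) by exact: inwin_flip.
  have p_vac : occ p (flip p (fvac N)) by rewrite occ_flip occ_vac eqxx ltNge p0.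
  have p_C : ~~ occ p (flip p C) by rewrite occ_flip eqxx pC.
  have := bilinear_pivot (bv n) vac_p pCn pn p_vac p_C.
  have := bilinear_pivot (bw n) vac_p pCn pn p_vac p_C.
  rewrite !flipK v1 w1 !mul1r => -> ->; congr (_ * _).
  rewrite big_seq_cond [RHS]big_seq_cond; apply: eq_bigr => h /andP[hn hp].
  rewrite /ladder; case: eqP => [|_]; last by rewrite !mul0r.
  rewrite occ_flip (negPf hp) occ_vac /= => h0; rewrite flipC vw //.
  congr (_ * _); case: ifP => // _; congr (_ * _); apply: IH.
    by rewrite nparticles_flip_hole // -ltnS -(nparticles_flip pn p0 pC).
  exact: inwin_flip.
(* With a hole [g] but no particle the coefficient is zero. In the identity at [C] with [g] filled
   and the vacuum with hole [g], a mode other than [g] occupied in the first state is negative,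
   hence occupied in the second as well. *)
have [/hasP[g gn /andP[g0 gC]]|/hasPn noH] :=
  boolP (has (fun x : mode N => (x.2 < 0) && ~~ occ x C) (modes N n)).
  have vac_g : inwin n (flip g (fvac N)) by apply: inwin_flip => //; exact: inwin_vac.
  have gCn : inwin n (flip g C) by exact: inwin_flip.
  have g_C : occ g (flip g C) by rewrite occ_flip eqxx /= gC.
  have g_vac : ~~ occ g (flip g (fvac N)) by rewrite occ_flip occ_vac eqxx g0.
  have zero (u : fock L N) : bilinear_identity n u -> u (fvac N) = 1 -> u C = 0.
    move=> bu u1; have := bilinear_pivot bu gCn vac_g gn g_C g_vac.
    rewrite !flipK u1 mulr1 => ->; rewrite big_seq_cond big1 ?mulr0 // => x /andP[xn xg].
    rewrite /ladder !occ_flip (negPf xg) /= occ_vac.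
    case: eqP => [xC|_]; last by rewrite mul0r.
    case: ltP => [_|x0]; first by rewrite mulr0.
    by have := noP x xn; rewrite x0 xC.
  by rewrite !zero.
suff -> : C = fvac N by rewrite v1 w1.
apply: fbasis_ext => x; rewrite occ_vac.
have [xn|/Cn//] := boolP (x \in modes N n).
have := noP x xn; have := noH x xn; case: ltP => _ /=; first by rewrite negbK.
by move=> _ /negPf.
Qed.

End Uniqueness.

(** * Finite sums over the states of a window, and adjointness *)

Section Cube.
Variable N : nat.
Implicit Types (x y : mode N) (C D : fbasis N).

(** Each mode added to the list at most doubles the set: either [C] or [flip y C] agrees with the
    vacuum at [y]. *)
Lemma finite_cube n : finite_set [set C | inwin (N := N) n C].
Proof.
rewrite /inwin; elim: (modes N n) => [|y s IH].
  apply: (@sub_finite_set _ _ [set fvac N]) => // C /= Cv.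
  by apply: fbasis_ext => x; rewrite Cv ?occ_vac.
apply: (@sub_finite_set _ _ ([set C | forall x, x \notin s -> occ x C = (x.2 < 0)] `|`
   flip y @` [set C | forall x, x \notin s -> occ x C = (x.2 < 0)])); last first.
  by rewrite finite_setU; split=> //; exact: finite_image.
move=> C /= Cs; have [yC|yC] := eqVneq (occ y C) (y.2 < 0).
  left=> x xs; have [->//|xy] := eqVneq x y.
  by apply: Cs; rewrite inE negb_or xy.
right; exists (flip y C); last by rewrite flipK.
move=> x xs; rewrite occ_flip; have [->|xy] /= := eqVneq x y.
  by move: yC; case: occ; case: (_ < _).
by apply: Cs; rewrite inE negb_or xy.
Qed.

Definition cube n : seq (fbasis N) := fset_set [set C | inwin n C].

Lemma uniq_cube n : uniq (cube n). Proof. exact: fset_uniq. Qed.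

Lemma cubeP n C : reflect (inwin n C) (C \in cube n).
Proof.
rewrite /cube in_fset_set; last exact: finite_cube.
by apply: (iffP idP); rewrite inE.
Qed.

Lemma sum_cube_flip (V : nmodType) n y (F : fbasis N -> V) : y \in modes N n ->
  \sum_(C <- cube n) F C = \sum_(C <- cube n) F (flip y C).
Proof.
move=> yn; rewrite -[RHS](big_map (flip y) xpredT F); apply: perm_big.
apply: uniq_perm; rewrite ?map_inj_uniq ?uniq_cube //; first exact: can_inj (@flipK _ y).
move=> C; apply/cubeP/mapP => [Cn|[D /cubeP Dn ->]]; last exact: inwin_flip.
by exists (flip y C); rewrite ?flipK //; apply/cubeP/inwin_flip.
Qed.

Lemma ladder_adjoint (L : comNzRingType) n b y (u w : fock L N) : y \in modes N n ->
  \sum_(C <- cube n) ladder b y u C * w C =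
  \sum_(C <- cube n) u C * ladder (~~ b) y w C.
Proof.
move=> yn; rewrite (sum_cube_flip _ yn); apply: eq_bigr => C _.
rewrite /ladder occ_flip eqxx flipK sgn_flip precedesxx /= (can2_eq negbK negbK).
by case: ifP => _; rewrite ?mul0r ?mulr0 // mulrCA mulrA.
Qed.

End Cube.

(** * Splitting off tensor factors, and gluing over a window *)

Section Join.
Variables M N : nat.
Implicit Types (x : mode M) (y : mode N) (B : fbasis M) (C : fbasis N).

Definition lmode x : mode (M + N) := (lshift N x.1, x.2).
Definition rmode y : mode (M + N) := (rshift M y.1, y.2).

Lemma fjoin_lshift B C i : fjoin B C (lshift N i) = B i.
Proof. by rewrite ffunE -[lshift N i]/(unsplit (inl i)) unsplitK. Qed.

Lemma fjoin_rshift B C j : fjoin B C (rshift M j) = C j.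
Proof. by rewrite ffunE -[rshift M j]/(unsplit (inr j)) unsplitK. Qed.

Lemma occ_lmode x B C : occ (lmode x) (fjoin B C) = occ x B.
Proof. by rewrite /occ fjoin_lshift. Qed.

Lemma occ_rmode y B C : occ (rmode y) (fjoin B C) = occ y C.
Proof. by rewrite /occ fjoin_rshift. Qed.

Lemma mode_splitP (z : mode (M + N)) :
  (exists x, z = lmode x) \/ (exists y, z = rmode y).
Proof.
case: z => i r; case: (splitP i) => j ij; [left|right]; exists (j, r).
  by congr (_, _); apply: val_inj.
by congr (_, _); apply: val_inj.
Qed.

Lemma flip_lmode x B C : flip (lmode x) (fjoin B C) = fjoin (flip x B) C.
Proof.
apply: fbasis_ext => z; case: (mode_splitP z) => -[t ->]; rewrite occ_flip.
  by rewrite !occ_lmode occ_flip -!pair_eqE /pair_eq /= (inj_eq (@lshift_inj _ _)).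
by rewrite !occ_rmode -!pair_eqE /pair_eq /= eq_rlshift.
Qed.

Lemma flip_rmode y B C : flip (rmode y) (fjoin B C) = fjoin B (flip y C).
Proof.
apply: fbasis_ext => z; case: (mode_splitP z) => -[t ->]; rewrite occ_flip.
  by rewrite !occ_lmode -!pair_eqE /pair_eq /= eq_lrshift.
by rewrite !occ_rmode occ_flip -!pair_eqE /pair_eq /= (inj_eq (@rshift_inj _ _)).
Qed.

Lemma sgn_lmode x B C : sgn (lmode x) (fjoin B C) = sgn x B.
Proof.
rewrite /sgn /koszul /= fjoin_lshift big_split_ord /= [X in (_ + X + _)%N]big1 ?addn0.
  by congr (odd (_ + _)); apply: eq_bigr => i _; rewrite fjoin_lshift.
by move=> i; rewrite ltnNge (leq_trans (ltnW (ltn_ord x.1))) ?leq_addr.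
Qed.

(** The left factors contribute a sign that does not depend on [y], so it comes out of sums over the
    right modes. *)
Lemma sgn_rmode y B C :
  sgn (rmode y) (fjoin B C) = odd (\sum_i degree (B i)) (+) sgn y C.
Proof.
rewrite /sgn /koszul /= fjoin_rshift big_split_ord /= -addnA oddD; congr (odd _ (+) odd (_ + _)).
  apply: eq_big => [i|i _]; last by rewrite fjoin_lshift.
  by rewrite (leq_trans (ltn_ord i)) ?leq_addr.
by apply: eq_big => [i|i _]; rewrite ?fjoin_rshift ?ltn_add2l.
Qed.

Lemma inwin_fjoin n B C : inwin n B -> inwin n C -> inwin n (fjoin B C).
Proof.
move=> Bn Cn z; case: (mode_splitP z) => -[t ->]; rewrite mem_modes => tn.
  by rewrite occ_lmode Bn // mem_modes.
by rewrite occ_rmode Cn // mem_modes.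
Qed.

Lemma sum_modes_split (V : nmodType) n (F : mode (M + N) -> V) :
  \sum_(z <- modes (M + N) n) F z =
  \sum_(x <- modes M n) F (lmode x) + \sum_(y <- modes N n) F (rmode y).
Proof. by rewrite !(sum_modes _ xpredT) big_split_ord. Qed.

Lemma fjoin_vac : fjoin (fvac M) (fvac N) = fvac (M + N).
Proof.
by apply: fbasis_ext => z; case: (mode_splitP z) => -[t ->];
  rewrite ?occ_lmode ?occ_rmode !occ_vac.
Qed.

Section Glue.
Variable L : comNzRingType.
Implicit Types (V : fock L (M + N)) (W : fock L N).

Lemma ladder_lmode b x V B C :
  ladder b (lmode x) V (fjoin B C) = ladder b x (fun B' => V (fjoin B' C)) B.
Proof. by rewrite /ladder occ_lmode flip_lmode sgn_lmode. Qed.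

Lemma ladder_rmode b y V B C :
  ladder b (rmode y) V (fjoin B C) =
  (-1) ^+ odd (\sum_i degree (B i)) * ladder b y (fun C' => V (fjoin B C')) C.
Proof.
rewrite /ladder occ_rmode flip_rmode sgn_rmode signr_addb.
by case: ifP => _; rewrite ?mulr0 // mulrA.
Qed.

Lemma sum_prod_exchange (I J J' : Type) (r : seq I) (s : seq J) (s' : seq J')
    (F : I -> J -> L) (G : I -> J' -> L) :
  \sum_(x <- r) (\sum_(C <- s) F x C) * (\sum_(D <- s') G x D) =
  \sum_(C <- s) \sum_(D <- s') \sum_(x <- r) F x C * G x D.
Proof.
under eq_bigr do rewrite big_distrlr.
by rewrite exchange_big; apply: eq_bigr => C _; rewrite exchange_big.
Qed.

Definition cube_glue n V W : fock L M := fun B =>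
  \sum_(C <- cube N n) V (fjoin B C) * W C.

Lemma cube_glue_bilinear n V W : bilinear_identity n V -> bilinear_identity n W ->
  bilinear_identity n (cube_glue n V W).
Proof.
move=> bV bW B D Bn Dn.
have glueE b x B' : ladder b x (cube_glue n V W) B' =
    \sum_(C <- cube N n) ladder b (lmode x) V (fjoin B' C) * W C.
  rewrite ladder_sum; apply: eq_bigr => C _; rewrite ladder_lmode mulrC -ladderZ.
  by apply: ladder_ext => B''; rewrite mulrC.
under eq_bigr do rewrite !glueE.
rewrite sum_prod_exchange.
pose s B' : L := (-1) ^+ odd (\sum_i degree (B' i)).
pose u B' (C : fbasis N) := V (fjoin B' C).
(* The identity for [V] trades the modes of the left factors for minus those of the right factors,
   with the constant Koszul signs in front. *)
transitivity (- (s B * s D) * \sum_(y <- modes N n)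
    (\sum_(C <- cube N n) ladder true y (u B) C * W C) *
    (\sum_(C <- cube N n) ladder false y (u D) C * W C)).
  rewrite sum_prod_exchange mulr_sumr big_seq [RHS]big_seq.
  apply: eq_bigr => C /cubeP Cn.
  rewrite mulr_sumr big_seq [RHS]big_seq; apply: eq_bigr => C' /cubeP C'n.
  have := bV _ _ (inwin_fjoin Bn Cn) (inwin_fjoin Dn C'n).
  rewrite sum_modes_split => /eqP; rewrite addr_eq0 => /eqP E.
  under eq_bigr do rewrite mulrACA.
  rewrite -mulr_suml E -sumrN mulr_suml mulr_sumr; apply: eq_bigr => y _.
  by rewrite !ladder_rmode [in LHS]mulrACA [X in _ = _ * X]mulrACA !mulNr !mulrA.
rewrite (_ : \sum_(y <- modes N n) _ = 0) ?mulr0 //.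
(* Adjointness exchanges [true] and [false] on [W], so the identity for [W] is then used with its
   two states swapped. *)
transitivity (\sum_(y <- modes N n)
    (\sum_(C <- cube N n) u B C * ladder false y W C) *
    (\sum_(C <- cube N n) u D C * ladder true y W C)).
  rewrite big_seq [RHS]big_seq; apply: eq_bigr => y yn.
  by rewrite !(ladder_adjoint _ _ _ yn).
rewrite sum_prod_exchange.
rewrite big_seq big1 // => C /cubeP Cn; rewrite big_seq big1 // => C' /cubeP C'n.
under eq_bigr do rewrite mulrACA.
rewrite -mulr_sumr; under eq_bigr do rewrite mulrC.
by rewrite bW ?mulr0.
Qed.

End Glue.
End Join.

(** * Gluing of power series *)

Lemma bilinear_identityZ (L : comNzRingType) N n (v : fock L N) c :
  bilinear_identity n v -> bilinear_identity n (fun B => v B * c).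
Proof.
move=> bv B D Bn Dn.
have vc b x E : ladder b x (fun B => v B * c) E = c * ladder b x v E.
  by rewrite -ladderZ; apply: ladder_ext => F; rewrite mulrC.
under eq_bigr do rewrite !vc mulrACA.
by rewrite -mulr_sumr bv ?mulr0.
Qed.

(** Outside the window both states have the occupation of the vacuum, and [psi] needs the mode
    occupied while [psistar] needs it empty. *)
Lemma bilinear_sum_leq (L : comNzRingType) N m n (v : fock L N) B D :
  (m <= n)%N -> inwin m B -> inwin m D ->
  \sum_(x <- modes N m) ladder true x v B * ladder false x v D =
  \sum_(x <- modes N n) ladder true x v B * ladder false x v D.
Proof.
move=> mn Bm Dm.
have out x : x \notin modes N m -> ladder true x v B * ladder false x v D = 0.
  move=> xm; rewrite /ladder Bm // Dm //.
  by case: (_ < _); rewrite ?mulr0 ?mul0r.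
rewrite -(fsbigT_seq (uniq_modes N m) out); apply: fsbigT_seq => [|x xn].
  exact: uniq_modes.
by apply: out; apply: contra xn; exact: leq_modes.
Qed.

Section SeriesTruncation.
Variable L : comNzRingType.
Implicit Types f g : fps L.

(** Congruence modulo [Q^(d+1)]. *)
Definition eq_upto d f g : Prop := forall e, (e <= d)%N -> f e = g e.

Lemma eq_uptoM d f f' g g' : eq_upto d f f' -> eq_upto d g g' ->
  eq_upto d (f * g) (f' * g').
Proof.
move=> ff gg e ed; apply: eq_bigr => i _; rewrite ff ?gg //.
  exact: leq_trans (leq_subr _ _) ed.
by apply: leq_trans ed; rewrite -ltnS.
Qed.

Lemma fcoef_sum (I : Type) (r : seq I) (P : pred I) (F : I -> fps L) d :
  (\sum_(i <- r | P i) F i) d = \sum_(i <- r | P i) F i d.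
Proof. by apply: (big_morph (fun f : fps L => f d)) => //=; rewrite if_same. Qed.

Lemma eq_upto_ladder N d b x (v w : fock (fps L) N) C :
  eq_upto d (v (flip x C)) (w (flip x C)) ->
  eq_upto d (ladder b x v C) (ladder b x w C).
Proof. by move=> vw; rewrite /ladder; case: ifP => // _; apply: eq_uptoM. Qed.

(** Below [Q^n] only states of the window [n] occur, so modulo [Q^n] the formal inner product is a
    finite sum over the cube. *)
Definition locally_finite N (W : fock (fps L) N) : Prop :=
  forall n C d, ~ inwin n C -> (d < n)%N -> W C d = 0.

Lemma inner_cube N n (v W : fock (fps L) N) d : locally_finite W -> (d < n)%N ->
  eq_upto d (inner v W) (\sum_(C <- cube N n) v C * W C).
Proof.
move=> fW dn e ed; rewrite fcoef_sum [LHS]/=.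
rewrite (@fsbigT_seq _ _ (cube N n)) ?uniq_cube // => C /cubeP Cn.
rewrite [LHS]/= big1 // => i _; rewrite (fW n) ?mulr0 //.
exact: leq_ltn_trans (leq_subr _ _) (leq_ltn_trans ed dn).
Qed.

Lemma inner_last_bilinear M N (V : fock (fps L) (M + N)) (W : fock (fps L) N) :
  locally_finite W ->
  (forall n, bilinear_identity n V) -> (forall n, bilinear_identity n W) ->
  forall n, bilinear_identity n (inner_last V W).
Proof.
move=> fW bV bW m B D Bm Dm; apply/fpsP => d.
(* The window must contain the two given states and every state that matters up to [Q^d]. *)
pose n := maxn m d.+1; have mn : (m <= n)%N by exact: leq_maxl.
have dn : (d < n)%N by exact: leq_maxr.
rewrite (bilinear_sum_leq _ mn) //.
have := cube_glue_bilinear (bV n) (bW n) (inwin_leq mn Bm) (inwin_leq mn Dm).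
move/(congr1 (fun f : fps L => f d)) => <-; rewrite !fcoef_sum.
by apply: eq_bigr => x _; apply: (@eq_uptoM d) => //;
  apply: eq_upto_ladder; apply: inner_cube.
Qed.

End SeriesTruncation.

(** A pair [m, k] costs at least [Q^(m+k+1)], so below [Q^n] only modes of the window [n] can be
    flipped. *)
Lemma bogoliubov_locally_finite (L : comAlgType rat) N
    (A : 'I_N -> 'I_N -> nat -> nat -> fps L) :
  (forall i j m k d, (d < m + k + 1)%N -> A i j m k d = 0) ->
  locally_finite (bogoliubov A).
Proof.
move=> A0 n C d Cn dn.
suff it0 k : iter k (bilinear_exponent A) (ket _ (fvac N)) C d = 0.
  by apply: fcoef_sum0 => k _; rewrite [LHS]/= it0 scaler0.
elim: k C d Cn dn => [|k IH] C d Cn dn.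
  by rewrite /= /ket; case: eqP Cn => [->|_ _ //=]; [case; exact: inwin_vac|rewrite if_same].
apply: fcoef_sum0 => i _; apply: fcoef_sum0 => j _; apply: fcoef_sum0 => -[m l] _.
rewrite (psiE (i, Posz m)) (psistarE (j, Negz l)) /=.
apply: big1 => e _; have [le|le] := ltnP e (m + l + 1); first by rewrite A0 ?mul0r.
have en : (e < n)%N by apply: leq_ltn_trans dn; rewrite -ltnS.
have mn : (i, Posz m) \in modes N n.
  rewrite mem_modes mem_win; apply: leq_ltn_trans en; apply: leq_trans le.
  by rewrite -addnA leq_addr.
have ln : (j, Negz l) \in modes N n.
  rewrite mem_modes mem_win; apply: leq_ltn_trans en; apply: leq_trans le.
  by rewrite addnAC leq_addl.
suff -> : ladder true (i, Posz m) (ladder false (j, Negz l)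
    (iter k (bilinear_exponent A) (ket _ (fvac N)))) C (d - e)%N = 0 by rewrite mulr0.
(* Both modes lie in the window, so undoing their flips cannot bring [C] into it, and the induction
   hypothesis applies. *)
have C0 : eq_upto (d - e) (iter k (bilinear_exponent A) (ket _ (fvac N))
    (flip (j, Negz l) (flip (i, Posz m) C))) 0.
  move=> f fd; rewrite IH /= ?if_same //; last first.
    exact: leq_ltn_trans fd (leq_ltn_trans (leq_subr _ _) dn).
  move=> Fn; apply: Cn; rewrite -[C](flipK (i, Posz m)) -[flip _ C](flipK (j, Negz l)).
  by do 2 (apply: inwin_flip => //).
have C0' b x (w : fock (fps L) N) D : eq_upto (d - e) (w (flip x D)) 0 ->
    eq_upto (d - e) (ladder b x w D) 0.
  move=> w0; rewrite (_ : 0 = ladder b x (fun=> 0) D); first exact: eq_upto_ladder.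
  by rewrite /ladder mulr0 if_same.
by rewrite (C0' _ _ _ _ (C0' _ _ _ _ C0)) //= if_same.
Qed.

(** * Extension of scalars and the closed part *)

Section Gluing.
Variable K : comAlgType rat.

Lemma monomialD (x y : K) d e : monomial (x + y) d e = monomial x d e + monomial y d e.
Proof.
apply/fpsP => i /=; case: ifP => _; apply/laurentP => k /=; case: ifP => _ //=;
  by rewrite ?if_same ?addr0.
Qed.

Lemma const_seriesM (x y : K) : const_series (x * y) = const_series x * const_series y.
Proof.
apply/fpsP => -[|n] /=.
  rewrite big_ord1 /=; apply/laurentP => k /=.
  rewrite (@fsbigT_seq _ _ [:: 0]) //= => [|i]; last first.
    by rewrite inE => /negPf ->; rewrite mul0r.
  by rewrite big_seq1 eqxx subr0; case: ifP; rewrite ?mulr0.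
rewrite big1 // => i _; case: i => -[|i] ? /=; rewrite ?mulr0 ?mul0r //.
Qed.

Lemma const_series_sign b (x : K) :
  const_series ((-1) ^+ nat_of_bool b * x) = (-1) ^+ nat_of_bool b * const_series x.
Proof.
case: b; rewrite ?mul1r // !mulN1r; apply/eqP; rewrite -subr_eq0 opprK.
rewrite -monomialD addNr; apply/eqP/fpsP => i /=; case: ifP => _ //.
Qed.

Lemma extend_scalars_bilinear N n (v : fock K N) :
  bilinear_identity n v -> bilinear_identity n (extend_scalars v).
Proof.
have c0 : const_series (0 : K) = 0 by [].
have lad b x C : ladder b x (extend_scalars v) C = const_series (ladder b x v C).
  by rewrite /ladder; case: ifP => // _; rewrite const_series_sign.
move=> bv C D Cn Dn; rewrite -[RHS]c0 -(bv C D Cn Dn).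
rewrite (big_morph (@const_series K) (fun x y => monomialD x y 0 0) c0).
by apply: eq_bigr => x _; rewrite !lad const_seriesM.
Qed.

Lemma gluing_vector_locally_finite E : locally_finite (@gluing_vector K E).
Proof.
apply: bogoliubov_locally_finite => i j m k d dmk.
by rewrite /= ltn_eqF.
Qed.

(** Both sides solve the bilinear identity and agree on one-pair states, so uniqueness applies
    without expanding the exponential. *)
Lemma bogoliubov_fjoin_vac M N (A : 'I_(M + N) -> 'I_(M + N) -> nat -> nat -> K) C :
  bogoliubov A (fjoin (fvac M) C) =
  bogoliubov (fun i j => A (rshift M i) (rshift M j)) C.
Proof.
pose u : fock K N := fun C => bogoliubov A (fjoin (fvac M) C).
suff uE : u = bogoliubov (fun i j => A (rshift M i) (rshift M j)) by rewrite -uE.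
apply: bilinear_unique => [n D D' Dn D'n|n| | |p h p0 h0].
- have := bogoliubov_bilinear A (inwin_fjoin (inwin_vac (n := n)) Dn)
    (inwin_fjoin (inwin_vac (n := n)) D'n).
  (* The left modes drop out: there both states are the vacuum, so one of the two operators
     vanishes. *)
  rewrite sum_modes_split big1 ?add0r => [E|x _].
    rewrite -[RHS]E; apply: eq_bigr => y _.
    by rewrite !ladder_rmode mulrACA -signr_addb addbb mul1r.
  by rewrite /ladder !occ_lmode; case: occ; rewrite ?mulr0 ?mul0r.
- exact: bogoliubov_bilinear.
- by rewrite /u fjoin_vac bogoliubov_vac.
- exact: bogoliubov_vac.
rewrite /u -flip_rmode -flip_rmode fjoin_vac !bogoliubov_pair //.
rewrite -fjoin_vac flip_rmode !sgn_rmode; congr ((-1) ^+ (nat_of_bool _) * _).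
by rewrite addbACA addbb.
Qed.

Lemma gluing_vac M (A : 'I_(M + 2) -> 'I_(M + 2) -> nat -> nat -> K) E :
  gluing (bogoliubov A) E (fvac M) = gluing_closed A E.
Proof.
have VE : (fun C => extend_scalars (bogoliubov A) (fjoin (fvac M) C)) =
    extend_scalars (bogoliubov (fun i j => A (rshift M i) (rshift M j))).
  by apply/funext => C; rewrite /extend_scalars bogoliubov_fjoin_vac.
by rewrite /gluing /inner_last VE.
Qed.

End Gluing.

Lemma bilinear_bogoliubov (L : comAlgType rat) N (v : fock L N) :
  (forall n, bilinear_identity n v) -> v (fvac N) = 1 ->
  exists R, v = bogoliubov R.
Proof.
move=> bv v1.
pose s p h := sgn p (flip h (fvac N)) (+) sgn h (flip h (fvac N)).
(* The one-pair coefficient of [v], with the sign that cancels the one in [bogoliubov_pair]. *)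
pose R i j m k := (-1) ^+ s (i, Posz m) (j, Negz k) *
  v (flip (i, Posz m) (flip (j, Negz k) (fvac N))).
exists R; apply: bilinear_unique => // [n||[i [m|//]] [j [//|k]] _ _].
- exact: bogoliubov_bilinear.
- exact: bogoliubov_vac.
by rewrite bogoliubov_pair // /mode_coef /R /= mulrA -signr_addb addbb mul1r.
Qed.

Local Close Scope ring_scope.
Local Close Scope classical_set_scope.

Theorem theorem3p1 (K : comAlgType rat) (M : nat) (M_gt0 : 0 < M)
    (A : 'I_(M + 2) -> 'I_(M + 2) -> nat -> nat -> K)
    (E : 'I_2 -> 'I_2 -> nat -> nat -> K) :
  exists R : 'I_M -> 'I_M -> nat -> nat -> series K,
    normalized_gluing A E = bogoliubov R.
Proof.
apply: bilinear_bogoliubov => [n|]; last first.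
  (* At the vacuum the numerator is the closed part itself, so the normalized value is 1. *)
  by rewrite /normalized_gluing gluing_vac divrr // gluing_closed_unit.
(* The identity is homogeneous, so the division by the closed part does not affect it. *)
apply: bilinear_identityZ; apply: inner_last_bilinear => [|k|k].
- exact: gluing_vector_locally_finite.
- exact/extend_scalars_bilinear/bogoliubov_bilinear.
exact: bogoliubov_bilinear.
Qed.
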